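(* (i) Assume that $\Lambda\subseteq\mathbb{D}$ is a sampling set for $A^2(\mathbb{D})$. Then for all sufficiently small $\gamma>0$, the sets $\Lambda_n=\Lambda\cap B_{1-\gamma/n}$ form a Marcinkiewicz-Zygmund family for $\mathcal{P}_n$ in $A^2(\mathbb{D})$. (ii) Conversely, if $(\Lambda_n)$ is a Marcinkiewicz-Zygmund family for the polynomials $\mathcal{P}_n$ in $A^2(\mathbb{D})$, then every weak limit of $(\Lambda_n)$ is a sampling set for $A^2(\mathbb{D})$.
   Context: $\mathbb{D}$ is the open unit disk in $\mathbb{C}$. The Bergman space $A^2(\mathbb{D})$ consists of all analytic functions $f$ on $\mathbb{D}$ with finite norm $\|f\|_{A^2}=\big(\frac1\pi\int_{\mathbb{D}}|f(z)|^2\,dz\big)^{1/2}$, where $dz$ is area measure. Its reproducing kernel is $k(z,w)=(1-z\bar w)^{-2}$. $\mathcal{P}_n$ is the space of polynomials in $z$ of degree at most $n$, and $k_n(z,w)=\sum_{j=0}^n (j+1)(z\bar w)^j$ is the reproducing kernel of $\mathcal{P}_n$ with respect to the norm of $A^2(\mathbb{D})$. For $\gamma>0$, $B_{1-\gamma/n}=\{z\in\mathbb{D}:|z|<1-\gamma/n\}$. Sampling set: $\Lambda\subseteq\mathbb{D}$ is a sampling set for $A^2(\mathbb{D})$ if there are constants $A,B>0$ such that $A\|f\|_{A^2}^2\le\sum_{\lambda\in\Lambda}\frac{|f(\lambda)|^2}{k(\lambda,\lambda)}\le B\|f\|_{A^2}^2$ for all $f\in A^2(\mathbb{D})$. Marcinkiewicz-Zygmund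 family: a sequence of finite sets $\Lambda_n\subseteq\mathbb{D}$ is a Marcinkiewicz-Zygmund family for $\mathcal{P}_n$ in $A^2(\mathbb{D})$ if there are constants $A,B>0$ (independent of $n$) and $n_0$ such that for all $n\ge n_0$ and all $p\in\mathcal{P}_n$, $A\|p\|_{A^2}^2\le\sum_{\lambda\in\Lambda_n}\frac{|p(\lambda)|^2}{k_n(\lambda,\lambda)}\le B\|p\|_{A^2}^2$. Weak limit: let $d(E,F)$ be the Hausdorff distance between closed sets $E,F\subseteq\mathbb{D}$ with respect to the Euclidean (or the pseudohyperbolic) metric. A sequence of sets $\Lambda_n\subseteq\mathbb{D}$ converges weakly to $\Lambda\subseteq\mathbb{D}$ (and $\Lambda$ is a weak limit of $(\Lambda_n)$) if for all compact disks $B\subseteq\mathbb{D}$, $\lim_{n\to\infty}d\big((\Lambda_n\cap B)\cup\partial B,\ (\Lambda\cap B)\cup\partial B\big)=0$. *)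

(* Defs.v *)
From HB Require Import structures.
From mathcomp Require Import all_boot all_order all_algebra.
From mathcomp Require Import complex.
From mathcomp Require Import all_classical all_reals all_analysis.

Set Implicit Arguments.
Unset Strict Implicit.
Unset Printing Implicit Defensive.

Import Order.TTheory GRing.Theory Num.Theory.
Import numFieldNormedType.Exports.

Local Open Scope classical_set_scope.
Local Open Scope ring_scope.
Local Open Scope complex_scope.

Section Bergman.
Variable R : realType.
Local Notation C := R[i].

(* The norm `|z| of MathComp takes its values in C; [cabs z] is the same
   number in R. *)
Definition cabs (z : C) : R := ComplexField.Normc.normc z.

Definition unit_disk : set C := [set z | cabs z < 1].

Definition closed_disk (c : C) (r : R) : set C := [set z | cabs (z - c) <= r].

Definition circle (c : C) (r : R) : set C := [set z | cabs (z - c) = r].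

(* Local representation by convergent power series.  The regular algebra C^o
   is C with the topology of its norm. *)
Definition analytic_on (D : set C) (f : C -> C) : Prop :=
  forall z0, D z0 -> exists a : nat -> C,
    \forall z \near (z0 : C^o),
      series (fun k => a k * (z - z0) ^+ k : C^o) @ \oo --> (f z : C^o).

(* Functions on the disk are represented by total functions on C, whose values
   outside the disk are irrelevant.  The norm lives in \bar R: it is +oo when
   f is not square-integrable. *)
Definition bergman_norm (f : C -> C) : \bar R :=
  sqrte ((pi^-1)%:E *
    \int[@lebesgue_measure R \x @lebesgue_measure R]_(p in [set p : R * R | unit_disk (p.1 +i* p.2)])
      ((cabs (f (p.1 +i* p.2))) ^+ 2)%:E)%E.

Definition bergman_space : set (C -> C) :=
  [set f | analytic_on unit_disk f /\ (bergman_norm f < +oo)%E].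

Definition bergman_kernel (z w : C) : C := (1 - z * w^*) ^- 2.

Definition poly_kernel (n : nat) (z w : C) : C :=
  \sum_(j < n.+1) j.+1%:R * (z * w^*) ^+ j.

Definition poly_space (n : nat) : set {poly C} := [set p | (size p <= n.+1)%N].

(* Both kernels are real and positive on the diagonal of the unit disk, so that
   [complex.Re] below only changes the type of their values. *)
Definition sampling_set (L : set C) : Prop :=
  L `<=` unit_disk /\
  exists A B : R, [/\ 0 < A, 0 < B &
    forall f, bergman_space f ->
      (A%:E * bergman_norm f ^+ 2 <=
         \esum_(l in L) (cabs (f l) ^+ 2 / complex.Re (bergman_kernel l l))%:E)%E /\
      (\esum_(l in L) (cabs (f l) ^+ 2 / complex.Re (bergman_kernel l l))%:E <=
         B%:E * bergman_norm f ^+ 2)%E].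

(* Sequences of sets are indexed by n >= 1 (the radius 1 - g / n makes no sense
   for n = 0); the value at 0 is ignored. *)
Definition MZ_family (L : nat -> set C) : Prop :=
  (forall n, (0 < n)%N -> finite_set (L n) /\ L n `<=` unit_disk) /\
  exists (A B : R) (n0 : nat), [/\ 0 < A, 0 < B, (0 < n0)%N &
    forall n, (n0 <= n)%N -> forall p, poly_space n p ->
      (A%:E * bergman_norm (horner p) ^+ 2 <=
         \sum_(l \in L n) (cabs p.[l] ^+ 2 / complex.Re (poly_kernel n l l))%:E)%E /\
      (\sum_(l \in L n) (cabs p.[l] ^+ 2 / complex.Re (poly_kernel n l l))%:E <=
         B%:E * bergman_norm (horner p) ^+ 2)%E].

(* Empty for rho <= 0, which occurs for rho = 1 - g / n with n small. *)
Definition open_disk0 (rho : R) : set C :=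
  [set z | unit_disk z /\ cabs z < rho].

Definition euclidean_dist (z w : C) : R := cabs (z - w).

Definition pseudohyperbolic_dist (z w : C) : R :=
  cabs ((z - w) / (1 - z * w^*)).

(* The sets are not assumed closed: a set and its closure have the same
   distance to every other set. *)
Definition hausdorff_dist (d : C -> C -> R) (E F : set C) : \bar R :=
  maxe (ereal_sup [set ereal_inf [set (d x y)%:E | y in F] | x in E])
       (ereal_sup [set ereal_inf [set (d x y)%:E | x in E] | y in F]).

Definition weak_limit (d : C -> C -> R) (L_ : nat -> set C) (L : set C) : Prop :=
  L `<=` unit_disk /\
  forall (c : C) (r : R), 0 < r -> closed_disk c r `<=` unit_disk ->
    hausdorff_dist d ((L_ n `&` closed_disk c r) `|` circle c r)
                     ((L `&` closed_disk c r) `|` circle c r)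
      @[n --> \oo] --> 0%E.

End Bergman.

(* Main.v *)
Require Import Defs.
From HB Require Import structures.
From mathcomp Require Import all_boot all_order all_algebra.
From mathcomp Require Import complex.
From mathcomp Require Import all_classical all_reals all_analysis.
From mathcomp Require Import measurable_realfun ring lra zify.

Import Order.TTheory GRing.Theory Num.Theory.
Import numFieldNormedType.Exports.

Local Open Scope classical_set_scope.
Local Open Scope ring_scope.
Local Open Scope complex_scope.

(** Rotations make the monomials orthogonal in the Bergman space, and dilations
    give [W / (j + 1)] for the squared norm of [z ^ j], where [W] is the area of
    the disk divided by [pi].  So the norm of a polynomial is a weighted sum of
    its squared coefficients ([sqr_bergman_norm_horner]); [W] is kept as a
    symbol, since it multiplies all norms alike.

    Both parts then rest on one trick: applying the upper (Bessel) inequality to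
    a polynomial multiplied by [z ^ m].  The factor hardly changes the samples
    taken near the unit circle, while it makes the norm small.  No separation or
    density of the points enters.

    Part (i).  If [p] has degree at most [n] and [m] is about [K * n], the squared
    norm of [z ^ m * p] is at most that of [p] divided by [K + 1], and
    [|z| ^ (2 * m) >= 1 / 2] where [|z| >= 1 - g / n], if [g] is small with
    respect to [1 / K].  Hence the points with [|z| >= 1 - g / n] carry a small part
    of the sampling sum of [p] ([sampling_tail]) and can be dropped in the lower
    inequality; at the remaining points the two kernels are comparable
    ([diag_kernel_le], [diag_kernel_ge]).

    Part (ii).  Let [L] be a weak limit.  Finitely many points of [L] are limits of
    distinct points of the sets of the family, so the upper inequality passes to
    the limit for a fixed polynomial ([weak_limit_upper]).  For the lower
    inequality ([weak_limit_lower]), the trick applied to [z ^ m] alone makes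
    the points near the unit circle negligible, uniformly in [n]; the others are
    close to finitely many points of [L].  Several of them may collapse to the
    same point, but boundedly many: the Bessel inequality for the normalized
    kernel at that point counts them ([weak_limit_multiplicity]).  The
    inequalities for polynomials extend to the Bergman space by density
    ([sampling_set_of_bounds]).

    Density requires that a function with local power series be the limit of its
    Taylor polynomials on the whole disk ([taylor_uniform]).  There the maximum
    modulus principle replaces contour integrals: applied to the function
    divided by [z ^ n] it gives the Schwarz lemma ([schwarz_lemma]), which bounds
    the remainder once the coefficients are controlled ([cauchy_estimate]). *)

(** * Linear changes of variables in the plane *)
Section plane_measure.
Context {R : realType}.
Local Open Scope ereal_scope.
Local Notation mu := (@lebesgue_measure R).
Local Notation mu2 := (mu \x mu).
Local Notation plane := (measurableTypeR R * measurableTypeR R)%type.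
Implicit Types (a b c : R) (g : R * R -> \bar R).

Lemma measurable_affine a c :
  measurable_fun [set: measurableTypeR R]
    ((fun x => a * x + c)%R : measurableTypeR R -> measurableTypeR R).
Proof.
apply: measurable_funD; last exact: measurable_cst.
by apply: measurable_funM => //; exact: measurable_cst.
Qed.

Lemma lebesgue_measure_affine a c (A : set R) : (0 < a)%R -> measurable A ->
  mu A = a%:E * mu ((fun x => a * x + c)%R @^-1` A).
Proof.
move=> a0 mA.
pose phi : measurableTypeR R -> measurableTypeR R := (fun x => a * x + c)%R.
have mphi : measurable_fun setT phi := measurable_affine a c.
pose a' := NngNum (ltW a0).
have -> : a%:E * mu (phi @^-1` A) = mscale a' (measure_function_pushforward__canonical__measure_function_Measure mu mphi) A by [].
apply: lebesgue_measure_unique => // _ [[s t]] _ <-.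

have phiV : phi @^-1` `]s, t] = `]((s - c) / a)%R, ((t - c) / a)%R]%classic.
  apply/seteqP; split=> x /=; rewrite !in_itv /= ltr_pdivrMr// ler_pdivlMr// /phi;
  by rewrite ltrBlDr lerBrDr (mulrC x).
rewrite [RHS](_ : _ = a%:E * mu (phi @^-1` `]s, t])) // phiV.
rewrite !lebesgue_measure_itv /= !lte_fin ltr_pM2r ?invr_gt0// ltrD2r.
case: ifPn => st; last by rewrite mule0.
by rewrite -!EFinB -EFinM; congr (_%:E); field; rewrite gt_eqF.
Qed.

Lemma integral_affine a c (g : R -> \bar R) : (0 < a)%R ->
  measurable_fun [set: R] g -> (forall x, 0 <= g x) ->
  \int[mu]_x g x = a%:E * \int[mu]_x g (a * x + c)%R.
Proof.
move=> a0 mg g0.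
pose phi : measurableTypeR R -> measurableTypeR R := (fun x => a * x + c)%R.
have mphi : measurable_fun setT phi := measurable_affine a c.
pose a' := NngNum (ltW a0).
pose nu := mscale a' (measure_function_pushforward__canonical__measure_function_Measure mu mphi).
have -> : \int[mu]_x g x = \int[nu]_x g x.
  by apply: eq_measure_integral => A mA _; exact: lebesgue_measure_affine.
rewrite ge0_integral_mscale//=.
by congr (_ * _); rewrite ge0_integral_pushforward.
Qed.

(** Reduced by Fubini to an affine change of variable on the line.  Rotations
    are products of three such maps and their transposes, dilations of two. *)
Lemma integral_shear1 a b g : (0 < a)%R ->
  measurable_fun setT g -> (forall p, 0 <= g p) ->
  \int[mu2]_p g p = a%:E * \int[mu2]_p g (a * p.1 + b * p.2, p.2)%R.
Proof.
move=> a0 mg g0.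
have mh : measurable_fun setT (fun p : plane => (a * p.1 + b * p.2, p.2)%R : plane).
  apply: measurable_fun_pair => //.
  by apply: measurable_funD; apply: measurable_funM => //; exact: measurable_cst.
rewrite fubini_tonelli2// fubini_tonelli2//; last exact: (measurableT_comp mg mh).
rewrite -ge0_integralZl//=; last 3 first.
- apply: measurable_fun_fubini_tonelli_G => //.
  exact: (measurableT_comp mg mh).
- by move=> y _; apply: integral_ge0.
- exact: ltW.
apply: eq_integral => y _; rewrite /fubini_G/=.
apply: (integral_affine a (b * y)%R (fun x => g (x, y))) => //.
exact: measurableT_comp mg _.
Qed.

Lemma integral_shear2 a b g : (0 < a)%R ->
  measurable_fun setT g -> (forall p, 0 <= g p) ->
  \int[mu2]_p g p = a%:E * \int[mu2]_p g (p.1, b * p.1 + a * p.2)%R.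
Proof.
move=> a0 mg g0.
have mh : measurable_fun setT (fun p : plane => (p.1, b * p.1 + a * p.2)%R : plane).
  apply: measurable_fun_pair => //.
  by apply: measurable_funD; apply: measurable_funM => //; exact: measurable_cst.
rewrite fubini_tonelli1// fubini_tonelli1//; last exact: (measurableT_comp mg mh).
rewrite -ge0_integralZl//=; last 3 first.
- apply: measurable_fun_fubini_tonelli_F => //.
  exact: (measurableT_comp mg mh).
- by move=> y _; apply: integral_ge0.
- exact: ltW.
apply: eq_integral => x _; rewrite /fubini_F/=.
rewrite (integral_affine a (b * x)%R (fun y => g (x, y))) //; last exact: measurableT_comp mg _.
by congr (_ * _); apply: eq_integral => y _; rewrite addrC.
Qed.

End plane_measure.

(** * The modulus of complex numbers *)
#[local] Arguments cabs {R} z : simpl never.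

Section modulus.
Context {R : realType}.
Local Notation C := R[i].
Implicit Types (z w : C) (x : R).

Lemma cabs_ge0 z : 0 <= cabs z.
Proof. by case: z => a b; exact: sqrtr_ge0. Qed.

Lemma normC_cabs z : `|z| = (cabs z)%:C.
Proof. by []. Qed.

Lemma cabs0 : cabs (0 : C) = 0.
Proof. exact: ComplexField.Normc.normc0. Qed.

Lemma cabs1 : cabs (1 : C) = 1.
Proof. exact: ComplexField.Normc.normc1. Qed.

Lemma cabs_eq0 z : (cabs z == 0) = (z == 0).
Proof.
apply/eqP/eqP => [|->]; last exact: cabs0.
exact: ComplexField.Normc.eq0_normc.
Qed.

Lemma cabs_gt0 z : (0 < cabs z) = (z != 0).
Proof. by rewrite lt_def cabs_eq0 cabs_ge0 andbT. Qed.

Lemma cabsM z w : cabs (z * w) = cabs z * cabs w.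
Proof. exact: ComplexField.Normc.normcM. Qed.

Lemma cabsV z : cabs z^-1 = (cabs z)^-1.
Proof. exact: ComplexField.Normc.normcV. Qed.

Lemma cabsX z n : cabs (z ^+ n) = cabs z ^+ n.
Proof. by elim: n => [|n IHn]; rewrite ?expr0 ?cabs1// !exprS cabsM IHn. Qed.

Lemma cabsN z : cabs (- z) = cabs z.
Proof. exact: normcN. Qed.

Lemma cabsB z w : cabs (z - w) = cabs (w - z).
Proof. by rewrite -cabsN opprB. Qed.

Lemma ler_cabsD z w : cabs (z + w) <= cabs z + cabs w.
Proof. exact: le_normcD. Qed.

Lemma ler_cabsB z w : cabs (z - w) <= cabs z + cabs w.
Proof. by rewrite (le_trans (ler_cabsD _ _))// cabsN. Qed.

Lemma lerB_cabs z w : cabs z - cabs w <= cabs (z - w).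
Proof. by rewrite lerBlDr (le_trans _ (ler_cabsD _ _))// subrK. Qed.

Lemma ler_dist_cabs z w : `|cabs z - cabs w| <= cabs (z - w).
Proof. by rewrite ler_norml lerB_cabs andbT lerNl opprB cabsB lerB_cabs. Qed.

Lemma ler_cabs_sum (I : Type) (s : seq I) (P : pred I) (F : I -> C) :
  cabs (\sum_(i <- s | P i) F i) <= \sum_(i <- s | P i) cabs (F i).
Proof.
elim/big_ind2: _ => [|x1 x2 y1 y2 h1 h2|//]; first by rewrite cabs0.
by rewrite (le_trans (ler_cabsD _ _))// lerD.
Qed.

Lemma cabsR x : cabs x%:C = `|x|.
Proof. by rewrite /cabs/= expr0n/= addr0 sqrtr_sqr. Qed.

Lemma cabs_nat n : cabs (n%:R : C) = n%:R.
Proof. by rewrite -(rmorph_nat (real_complex R)) cabsR normr_nat. Qed.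

Lemma sqr_cabs z : cabs z ^+ 2 = complex.Re z ^+ 2 + complex.Im z ^+ 2.
Proof. by case: z => a b; rewrite /cabs/= sqr_sqrtr// addr_ge0 ?sqr_ge0. Qed.

Lemma mulJ_cabs z : z * z^* = (cabs z ^+ 2)%:C.
Proof. by rewrite -sqr_normc normC_cabs rmorphXn. Qed.

Lemma cabsJ z : cabs z^* = cabs z.
Proof. by case: z => a b; rewrite /cabs/= sqrrN. Qed.

(** The parallelogram law. *)
Lemma sqr_cabs_parallelogram z w :
  cabs (z + w) ^+ 2 + cabs (z - w) ^+ 2 = 2 * cabs z ^+ 2 + 2 * cabs w ^+ 2.
Proof. by case: z => a b; case: w => c d; rewrite !sqr_cabs/=; ring. Qed.

Lemma sqr_cabsD_le2 z w : cabs (z + w) ^+ 2 <= 2 * cabs z ^+ 2 + 2 * cabs w ^+ 2.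
Proof. by rewrite -sqr_cabs_parallelogram lerDl sqr_ge0. Qed.

Lemma cvg_cabs (u : nat -> C) w : cabs (u n - w) @[n --> \oo] --> (0 : R) ->
  cabs (u n) @[n --> \oo] --> cabs w.
Proof.
move=> uw; apply/cvgrPdist_le => e e0; have /cvgrPdist_le/(_ e e0) := uw.
apply: filterS => n; rewrite sub0r normrN ger0_norm ?cabs_ge0//.
by apply: le_trans; rewrite cabsB; exact: ler_dist_cabs.
Qed.

Lemma cvg_sqr {T : Type} {F : set_system T} {FF : Filter F} (f : T -> R) (a : R) :
  f t @[t --> F] --> a -> f t ^+ 2 @[t --> F] --> a ^+ 2.
Proof. by move=> fa; rewrite expr2; under eq_fun do rewrite expr2; exact: cvgM. Qed.

(** Rotating by [u] multiplies [z ^ i] and [z ^ (i + n)] by opposite numbers, which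
    tells the two monomials apart. *)
Lemma rootN1_exists n : (0 < n)%N -> exists2 u : C, u ^+ n = -1 & cabs u = 1.
Proof.
move=> n0; have un : (n.-root (-1 : C)) ^+ n = -1 by exact: rootCK.
exists (n.-root (-1 : C)) => //; apply/eqP.
rewrite -(@eqrXn2 _ n) ?cabs_ge0 ?ler01//.
by rewrite -cabsX un cabsN cabs1 expr1n.
Qed.

End modulus.

(** * Integrals over disks *)
Section disk_integral.
Context {R : realType}.
Local Notation C := R[i].
Local Notation mu := (@lebesgue_measure R).
Local Notation mu2 := (mu \x mu)%E.
Local Notation plane := (measurableTypeR R * measurableTypeR R)%type.
Implicit Types (h : C -> R) (g : C -> \bar R) (r : R).

(** Functions on [C] are integrated through the coordinates of the plane. *)
Definition plane_measurable h :=
  measurable_fun [set: plane]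
    (fun p => h (p.1 +i* p.2)).

Definition disk_integral r h : \bar R :=
  (\int[mu2]_(p in [set p : R * R | (cabs (p.1 +i* p.2) < r)%R])
     (h (p.1 +i* p.2))%:E)%E.

Lemma plane_measurableE (k : plane -> R) h :
  (forall x y, k (x, y) = h (x +i* y)) -> measurable_fun setT k ->
  plane_measurable h.
Proof. by move=> kh; apply: eq_measurable_fun => -[x y] _; exact: kh. Qed.

Lemma plane_measurable_horner (p : {poly C}) :
  plane_measurable (fun z => complex.Re p.[z]) /\
  plane_measurable (fun z => complex.Im p.[z]).
Proof.
elim/poly_ind: p => [|p c [IHr IHi]].
  by split; apply: (@plane_measurableE (cst 0)) => // x y; rewrite horner0.
pose re q := complex.Re p.[q.1 +i* q.2]; pose im q := complex.Im p.[q.1 +i* q.2].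
split.
- apply: (@plane_measurableE (fun q => re q * q.1 - im q * q.2 + complex.Re c)).
    by move=> x y; rewrite hornerMXaddC /re /im /=; case: p.[_]; case: c.
  by apply: measurable_funD => //; apply: measurable_funB; exact: measurable_funM.
- apply: (@plane_measurableE (fun q => re q * q.2 + im q * q.1 + complex.Im c)).
    move=> x y; rewrite hornerMXaddC /re /im /=; case: p.[_] => a b; case: c => c d /=.
    by ring.
  by apply: measurable_funD => //; apply: measurable_funD; exact: measurable_funM.
Qed.

Lemma plane_measurable_cabs2 (f : C -> C) :
  plane_measurable (fun z => complex.Re (f z)) ->
  plane_measurable (fun z => complex.Im (f z)) ->
  plane_measurable (fun z => cabs (f z) ^+ 2).
Proof.
move=> mr mi; apply: (@plane_measurableE
  (fun p => complex.Re (f (p.1 +i* p.2)) ^+ 2 + complex.Im (f (p.1 +i* p.2)) ^+ 2)).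
  by move=> x y; rewrite sqr_cabs.
by apply: measurable_funD; exact: measurable_funX.
Qed.

Lemma plane_measurable_horner_cabs2 (p : {poly C}) :
  plane_measurable (fun z => cabs p.[z] ^+ 2).
Proof. by have [] := plane_measurable_horner p; exact: plane_measurable_cabs2. Qed.

Lemma plane_measurable_cabs : plane_measurable (@cabs R).
Proof.
apply: (@plane_measurableE (Num.sqrt \o (fun p => cabs (p.1 +i* p.2) ^+ 2))).
  by move=> x y /=; rewrite sqrtr_sqr ger0_norm ?cabs_ge0.
apply: measurableT_comp.
  by apply: continuous_measurable_fun; exact: sqrt_continuous.
apply: eq_measurable_fun (plane_measurable_horner_cabs2 'X) => p _.
by rewrite hornerX.
Qed.

Lemma measurable_disk r : measurable
  ([set p | cabs (p.1 +i* p.2) < r] : set (plane)).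
Proof.
have := @measurable_fun_ltr _ _ _ setT _ _ plane_measurable_cabs
  (@measurable_cst _ _ _ _ setT r).
rewrite -[X in measurable X]setTI => /(_ measurableT [set true]); apply => //.
Qed.

Lemma measurable_disk_restrict r h : plane_measurable h ->
  measurable_fun [set: plane] (fun p =>
    if cabs (p.1 +i* p.2) < r then (h (p.1 +i* p.2))%:E else 0%E).
Proof.
move=> mh; apply: measurable_fun_ifT => //; last exact/measurable_EFinP.
exact: measurable_fun_ltr plane_measurable_cabs (measurable_cst _).
Qed.

Lemma disk_integralE r h : disk_integral r h =
  (\int[mu2]_p if (cabs (p.1 +i* p.2) < r)%R then (h (p.1 +i* p.2))%:E else 0)%E.
Proof.
rewrite /disk_integral integral_mkcond; apply: eq_integral => p _.
by rewrite patchE; case: ifPn => [|/negP pr]; [rewrite inE /= => ->|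
  case: ifPn => // /mem_set].
Qed.

Lemma eq_disk_integral r h1 h2 : (forall z, h1 z = h2 z) ->
  disk_integral r h1 = disk_integral r h2.
Proof. by move=> e; apply: eq_integral => p _; rewrite e. Qed.

Lemma disk_integral_ge0 r h : (forall z, 0 <= h z) -> (0 <= disk_integral r h)%E.
Proof. by move=> h0; apply: integral_ge0 => p _; rewrite lee_fin. Qed.

Lemma le_disk_integral r h1 h2 : plane_measurable h1 -> plane_measurable h2 ->
  (forall z, 0 <= h1 z) -> (forall z, cabs z < r -> h1 z <= h2 z) ->
  (disk_integral r h1 <= disk_integral r h2)%E.
Proof.
move=> m1 m2 h0 h12; apply: ge0_le_integral => //.
- exact: measurable_disk.
- by move=> p _; rewrite lee_fin.
- by apply/measurable_EFinP; exact: measurable_funS m1.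
- by apply/measurable_EFinP; exact: measurable_funS m2.
- by move=> p /h12; rewrite lee_fin.
Qed.

Lemma disk_integralD r h1 h2 : plane_measurable h1 -> plane_measurable h2 ->
  (forall z, 0 <= h1 z) -> (forall z, 0 <= h2 z) ->
  disk_integral r (fun z => h1 z + h2 z) =
  (disk_integral r h1 + disk_integral r h2)%E.
Proof.
move=> m1 m2 h10 h20; rewrite /disk_integral -ge0_integralD//.
- exact: measurable_disk.
- by move=> p _; rewrite lee_fin.
- by apply/measurable_EFinP; exact: measurable_funS m1.
- by move=> p _; rewrite lee_fin.
- by apply/measurable_EFinP; exact: measurable_funS m2.
Qed.

Lemma disk_integralZ r c h : plane_measurable h -> 0 <= c ->
  (forall z, 0 <= h z) ->
  disk_integral r (fun z => c * h z) = (c%:E * disk_integral r h)%E.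
Proof.
move=> mh c0 h0; rewrite /disk_integral -ge0_integralZl//.
- exact: measurable_disk.
- by apply/measurable_EFinP; exact: measurable_funS mh.
- by move=> p _; rewrite lee_fin.
Qed.

(** With [u = c + i * s] and [s != 0], the rotation is the shear of slope
    [t = (c - 1) / s] along the first axis, then the one of slope [s] along the
    second, then the first one again. *)
Lemma integral_rotation (u : C) g : cabs u = 1 ->
  measurable_fun [set: plane]
     (fun p => g (p.1 +i* p.2)) -> (forall z, 0 <= g z)%E ->
  (\int[mu2]_p g (p.1 +i* p.2) = \int[mu2]_p g (u * (p.1 +i* p.2))%R)%E.
Proof.
move=> u1 mg g0.
(* a real u is the product of two unit numbers that are not real *)
wlog imu : u u1 g mg g0 / complex.Im u != 0 => [H|].
  have [imu|] := eqVneq (complex.Im u) 0; last exact: H.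
  have i1 : cabs ('i : C) = 1.
    by rewrite /cabs/= expr0n/= add0r expr1n sqrtr1.
  have mul_meas w : measurable_fun [set: plane]
      (fun p => g (w * (p.1 +i* p.2))).
    pose f (p : plane) :
      plane :=
      (complex.Re w * p.1 - complex.Im w * p.2, complex.Re w * p.2 + complex.Im w * p.1).
    have mf : measurable_fun setT f.
      apply: measurable_fun_pair; [apply: measurable_funB|apply: measurable_funD];
      by apply: measurable_funM => //; exact: measurable_cst.
    apply: (eq_measurable_fun ((fun p => g (p.1 +i* p.2)) \o f)).
      by move=> [x y] _ /=; case: w @f mf => a b.
    exact: (measurableT_comp mg mf).
  rewrite (H 'i i1)//=.
  rewrite (H (- 'i * u) _ (fun z => g ('i * z)))//=.
  - by apply: eq_integral => p _; rewrite !mulrA mulrN -expr2 sqr_i opprK mul1r.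
  - by rewrite cabsM cabsN i1 u1 mulr1.
  - case: u u1 imu => a b u1 /= b0; have := sqr_cabs (a +i* b).
    rewrite u1 /= b0 => a1; apply/eqP => e.
    have a0 : a = 0 by lra.
    by rewrite a0 in a1; lra.
case: u u1 imu => c s u1 /= s0.
have cs1 : c ^+ 2 + s ^+ 2 = 1 by have := sqr_cabs (c +i* s); rewrite u1 expr1n.
pose t := (c - 1) / s.
pose G (p : R * R) := g (p.1 +i* p.2).
have mG : measurable_fun [set: plane] G := mg.
have G0 p : (0 <= G p)%E by exact: g0.
pose X (p : plane) : plane := (1 * p.1 + t * p.2, p.2).
pose Y (p : plane) : plane := (p.1, s * p.1 + 1 * p.2).
have mX : measurable_fun setT X.
  apply: measurable_fun_pair => //.
  by apply: measurable_funD; apply: measurable_funM => //; exact: measurable_cst.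
have mY : measurable_fun setT Y.
  apply: measurable_fun_pair => //.
  by apply: measurable_funD; apply: measurable_funM => //; exact: measurable_cst.
transitivity (\int[mu2]_p G p)%E; first by [].
rewrite (@integral_shear1 _ 1 t)// mul1e.
have mGX := measurableT_comp mG mX.
rewrite (@integral_shear2 _ 1 s (G \o X) ltr01 mGX (fun p => G0 _)) mul1e.
rewrite (@integral_shear1 _ 1 t (G \o X \o Y) ltr01 (measurableT_comp mGX mY) (fun p => G0 _)).
rewrite mul1e; apply: eq_integral => -[x y] _; rewrite /G/X/Y/=.
have c2 : c ^+ 2 = 1 - s ^+ 2 by rewrite -cs1 addrK.
congr g; apply/eqP; rewrite eq_complex /=; apply/andP; split; apply/eqP.
  rewrite /t; field: c2; exact: s0.
by rewrite /t; field.
Qed.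

Lemma disk_integral_rotation r (u : C) h : cabs u = 1 -> plane_measurable h ->
  (forall z, 0 <= h z) ->
  disk_integral r (fun z => h (u * z)) = disk_integral r h.
Proof.
move=> u1 mh h0; rewrite !disk_integralE.
rewrite (@integral_rotation u (fun z => if (cabs z < r)%R then (h z)%:E else 0)%E)//.
- by apply: eq_integral => p _; rewrite cabsM u1 mul1r.
- exact: measurable_disk_restrict.
- by move=> z; case: ifP => //; rewrite lee_fin.
Qed.

Lemma disk_integral_dilation r h : 0 < r -> plane_measurable h ->
  (forall z, 0 <= h z) ->
  disk_integral r h = ((r ^+ 2)%:E * disk_integral 1 (fun z => h (r%:C * z)%R))%E.
Proof.
move=> r0 mh h0; rewrite !disk_integralE.
have rM x y : r%:C * (x +i* y) = (r * x) +i* (r * y).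
  by apply/eqP; rewrite eq_complex /= !mul0r subr0 addr0 !eqxx.
set g := (fun p : R * R => if (cabs (p.1 +i* p.2) < r)%R then (h (p.1 +i* p.2))%:E else 0)%E.
have mg : measurable_fun [set: plane] g.
  exact: measurable_disk_restrict.
have g0 p : (0 <= g p)%E by rewrite /g; case: ifP => //; rewrite lee_fin.
have mX : measurable_fun setT (fun p : plane =>
    ((r * p.1 + 0 * p.2)%R, p.2) : plane).
  apply: measurable_fun_pair => //.
  by apply: measurable_funD; apply: measurable_funM => //; exact: measurable_cst.
rewrite (@integral_shear1 _ r 0 g r0 mg g0).
rewrite (@integral_shear2 _ r 0 _ r0 (measurableT_comp mg mX) (fun p => g0 _)).
rewrite muleA -EFinM -expr2; congr (_ * _)%E; apply: eq_integral => -[x y] _.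
rewrite /g /= !mul0r addr0 add0r rM; congr (if _ then _ else _).
by rewrite -rM cabsM cabsR gtr0_norm// -{2}(mulr1 r) ltr_pM2l.
Qed.

Lemma disk_integral1_fin_num : disk_integral 1 (cst 1) \is a fin_num.
Proof.
rewrite ge0_fin_numE; last exact: disk_integral_ge0.
rewrite /disk_integral (integral_cst _ (measurable_disk 1) 1%E) mul1e.
pose Q : set (plane) :=
  `]-1, 1[%classic `*` `]-1, 1[%classic.
apply: (@le_lt_trans _ _ (mu2 Q)).
  apply: le_measure; rewrite ?inE; [exact: measurable_disk|exact: measurableX|].
  move=> [x y] /= xy1; have := sqr_cabs (x +i* y); have := cabs_ge0 (x +i* y).
  by move=> /= k0 e; split => /=; rewrite in_itv /=; apply/andP; split; nra.
rewrite /Q product_measure1E//.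
change (mu `](-1)%R, 1%R[%classic * mu `](-1)%R, 1%R[%classic < +oo)%E.
rewrite !lebesgue_measure_itv /= lte_fin.
by case: ifP => _; rewrite ?mul0e// -EFinB -EFinM ltry.
Qed.

End disk_integral.

(** * Norms of monomials *)
Section polynomial_norm.
Context {R : realType}.
Local Notation C := R[i].
Implicit Types (r : R) (p q h : {poly C}).

Definition disk_area : R := fine (disk_integral 1 (@cst C R 1)).

Lemma disk_areaE : disk_integral 1 (@cst C R 1) = disk_area%:E.
Proof. by rewrite /disk_area fineK// disk_integral1_fin_num. Qed.

Lemma disk_area_ge0 : 0 <= disk_area.
Proof. by apply: fine_ge0; apply: disk_integral_ge0. Qed.

Lemma horner_ge0_at1 (P : {poly R}) :
  (forall x, 0 < x -> x < 1 -> 0 <= P.[x]) -> 0 <= P.[1].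
Proof.
move=> P0; rewrite leNgt; apply/negP => P1.
have Pneg : \forall x \near (1 : R)^'-, P.[x] < 0.
  by apply: (cvgr_lt P.[1]) P1; exact/cvg_at_left_filter/continuous_horner.
near (1 : R)^'- => x.
have : 0 <= P.[x].
  by apply: P0; near: x; [exact: nbhs_left_gt|exact: nbhs_left_lt].
by rewrite leNgt; apply/negP; rewrite negbK; near: x.
Unshelve. all: by end_near. Qed.

Lemma plane_measurable_cst c : plane_measurable (@cst C R c).
Proof. exact: measurable_cst. Qed.

Definition monomial2 n (z : C) : R := cabs (z ^+ n) ^+ 2.

Lemma plane_measurable_monomial2 n : plane_measurable (monomial2 n).
Proof.
apply: eq_measurable_fun (plane_measurable_horner_cabs2 ('X^n : {poly C})) => z _.
by rewrite hornerXn.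
Qed.

Lemma disk_integral_sub r (g : C -> R) : r <= 1 ->
  disk_integral r g = disk_integral 1 (fun z => if cabs z < r then g z else 0).
Proof.
move=> r1; rewrite !disk_integralE; apply: eq_integral => p _.
case: ltP => // pr; first by rewrite (lt_le_trans pr r1).
by rewrite if_same.
Qed.

Lemma plane_measurable_if r (g : C -> R) : plane_measurable g ->
  plane_measurable (fun z => if cabs z < r then g z else 0).
Proof.
move=> mg; apply: measurable_fun_ifT => //.
exact: measurable_fun_ltr plane_measurable_cabs (measurable_cst _).
Qed.

(** With [x = r ^ 2], [V] the area of the disk and [M] the integral, dilation gives
    [M * (1 - x ^ n.+1)] for the integral over the annulus [r <= |z| < 1], whose
    area is [V * (1 - x)] and where the integrand is between [x ^ n] and [1];
    divide by [1 - x] and let [x] tend to [1]. *)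
Lemma disk_integral_monomial2 n :
  disk_integral 1 (monomial2 n) = (disk_area / n.+1%:R)%:E.
Proof.
have m0 z : 0 <= monomial2 n z by rewrite sqr_ge0.
have mm := plane_measurable_monomial2 n.
have mc := plane_measurable_cst 1.
have Mfin : disk_integral 1 (monomial2 n) \is a fin_num.
  rewrite ge0_fin_numE ?disk_integral_ge0//.
  apply: le_lt_trans (_ : disk_area%:E < +oo)%E; last exact: ltry.
  rewrite -disk_areaE; apply: le_disk_integral => // z z1.
  by rewrite /monomial2 cabsX -exprM exprn_ile1 ?cabs_ge0// ltW.
set M := fine (disk_integral 1 (monomial2 n)).
have ME : disk_integral 1 (monomial2 n) = M%:E by rewrite /M fineK.
have dil r : 0 < r -> disk_integral r (monomial2 n) = (r ^+ (2 * n.+1) * M)%:E.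
  move=> r0; rewrite disk_integral_dilation//.
  rewrite (@eq_disk_integral _ _ _ (fun z => r ^+ (2 * n) * monomial2 n z)).
    by rewrite disk_integralZ ?exprn_ge0 ?ltW// ME -!EFinM mulrA -exprD mulnS.
  by move=> z; rewrite /monomial2 !cabsX cabsM cabsR gtr0_norm// !exprMn -exprM mulnC.
have dilA r : 0 < r -> disk_integral r (@cst C R 1) = (r ^+ 2 * disk_area)%:E.
  by move=> r0; rewrite disk_integral_dilation// disk_areaE.
(* integrals over the annulus are avoided by moving terms across *)
have upper r : 0 < r -> r < 1 ->
    M + r ^+ 2 * disk_area <= r ^+ (2 * n.+1) * M + disk_area.
  move=> r0 r1; rewrite -lee_fin !EFinD -ME -dilA// -dil// -disk_areaE.
  rewrite !(@disk_integral_sub r _ (ltW r1)) -!disk_integralD//; try exact: plane_measurable_if.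
  - apply: le_disk_integral => //.
    + by apply: measurable_funD => //; exact: plane_measurable_if.
    + by apply: measurable_funD => //; exact: plane_measurable_if.
    + by move=> z; rewrite addr_ge0//; case: ifP.
    + move=> z z1; case: ifP => _ //=; rewrite add0r addr0.
      by rewrite /monomial2 cabsX -exprM exprn_ile1 ?cabs_ge0// ltW.
  - by move=> z; case: ifP.
  - by move=> z; case: ifP.
have lower r : 0 < r -> r < 1 ->
    r ^+ (2 * n) * disk_area + r ^+ (2 * n.+1) * M <= M + r ^+ (2 * n) * (r ^+ 2 * disk_area).
  move=> r0 r1; have rn0 : 0 <= r ^+ (2 * n) by rewrite exprn_ge0// ltW.
  rewrite -lee_fin !EFinD [X in (_ <= _ + X)%E]EFinM EFinM -ME -dilA// -dil// -disk_areaE.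
  rewrite !(@disk_integral_sub r _ (ltW r1)).
  have mif g : plane_measurable g -> plane_measurable (fun z => if cabs z < r then g z else 0).
    exact: plane_measurable_if.
  have if0 (g : C -> R) : (forall z, 0 <= g z) -> forall z, 0 <= if cabs z < r then g z else 0.
    by move=> g0 z; case: ifP.
  have mZ g : plane_measurable g -> plane_measurable (fun z : C => r ^+ (2 * n) * g z).
    by move=> mg; apply: measurable_funM => //; exact: measurable_cst.
  have Z0 (g : C -> R) : (forall z, 0 <= g z) -> forall z, 0 <= r ^+ (2 * n) * g z.
    by move=> g0 z; rewrite mulr_ge0.
  have mfi := mif _ mm; have mci := mif _ mc; have mcZ := mZ _ mc.
  have mciZ := mZ _ mci.
  rewrite -!disk_integralZ//; try exact: if0.
  rewrite -!disk_integralD//; do ?[exact: if0|exact: Z0|exact/Z0/if0].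
  apply: le_disk_integral.
  - exact: measurable_funD mcZ mfi.
  - exact: measurable_funD mm mciZ.
  - by move=> z; rewrite addr_ge0 ?Z0 ?if0.
  - move=> z z1; case: ltP => zr /=; first by rewrite addrC.
    rewrite mulr1 mulr0 !addr0 /monomial2 cabsX -exprM mulnC.
    by rewrite lerXn2r// nnegrE ?cabs_ge0// ltW.
pose S : {poly R} := \sum_(i < n.+1) 'X^i.
have SE x : S.[x] = \sum_(i < n.+1) x ^+ i.
  by rewrite /S horner_sum; apply: eq_bigr => i _; rewrite hornerXn.
have S1 x : (1 - x) * S.[x] = 1 - x ^+ n.+1.
  by rewrite SE -[LHS]opprK -mulNr opprB -subrX1 opprB.
have key x : 0 < x -> x < 1 -> x ^+ n * disk_area <= M * S.[x] <= disk_area.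
  move=> x0 x1; pose r := Num.sqrt x.
  have rx : r ^+ 2 = x by rewrite sqr_sqrtr// ltW.
  have r0 : 0 < r by rewrite sqrtr_gt0.
  have r1 : r < 1 by rewrite -sqrtr1 ltr_sqrt.
  have := upper r r0 r1; have := lower r r0 r1; rewrite !exprM !rx.
  have x10 : 0 < 1 - x by rewrite subr_gt0.
  have := S1 x; set s := S.[x]; set y := x ^+ n.+1; set w := x ^+ n.
  move=> sy lo up; apply/andP; split; rewrite -(ler_pM2l x10).
    have -> : (1 - x) * (M * s) = M * ((1 - x) * s) by ring.
    rewrite sy; lra.
  have -> : (1 - x) * (M * s) = M * ((1 - x) * s) by ring.
  rewrite sy; lra.
rewrite ME; congr (_%:E).
apply: (@mulIf _ n.+1%:R); first by rewrite pnatr_eq0.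
rewrite divfK ?pnatr_eq0//.
have S11 : S.[1] = n.+1%:R.
  by rewrite SE (eq_bigr (fun=> 1)) ?sumr_const ?card_ord// => i _; rewrite expr1n.
apply/eqP; rewrite eq_le -S11; apply/andP; split.
  rewrite -subr_ge0.
  have -> : disk_area - M * S.[1] = (disk_area%:P - M *: S).[1].
    by rewrite hornerD hornerN hornerZ hornerC.
  apply: horner_ge0_at1 => x x0 x1.
  rewrite hornerD hornerN hornerZ hornerC subr_ge0.
  by case/andP: (key _ x0 x1).
rewrite -subr_ge0.
have -> : M * S.[1] - disk_area = (M *: S - disk_area *: 'X^n).[1].
  by rewrite hornerD hornerN !hornerZ hornerXn expr1n mulr1.
apply: horner_ge0_at1 => x x0 x1.
rewrite hornerD hornerN !hornerZ hornerXn subr_ge0 mulrC.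
by case/andP: (key _ x0 x1).
Qed.

End polynomial_norm.

(** * Orthogonality and norms of polynomials *)
Section polynomial_norm2.
Context {R : realType}.
Local Notation C := R[i].
Implicit Types (r : R) (p q h : {poly C}).

Definition coef_norm2 p : R := \sum_(j < size p) cabs p`_j ^+ 2 / j.+1%:R.

Lemma coef_norm2E n p : (size p <= n)%N ->
  coef_norm2 p = \sum_(j < n) cabs p`_j ^+ 2 / j.+1%:R.
Proof.
move=> pn; rewrite /coef_norm2 (big_ord_widen _ (fun j => cabs p`_j ^+ 2 / j.+1%:R) pn).
rewrite [RHS](bigID (fun j : 'I_n => (j < size p)%N))/= [X in _ = _ + X]big1 ?addr0//.
by move=> j; rewrite -leqNgt => jp; rewrite nth_default// cabs0 expr0n mul0r.
Qed.

Lemma coef_norm2_ge0 p : 0 <= coef_norm2 p.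
Proof. by apply: sumr_ge0 => j _; rewrite divr_ge0 ?sqr_ge0. Qed.

(** Two polynomials that a rotation multiplies by opposite unit numbers are
    orthogonal, by the parallelogram law. *)
Lemma disk_integral_orthogonal q h (u lam : C) : cabs u = 1 -> cabs lam = 1 ->
  (forall z, q.[u * z] = lam * q.[z]) -> (forall z, h.[u * z] = - lam * h.[z]) ->
  (disk_integral 1 (fun z => (cabs (q + h).[z] ^+ 2)%R) =
   disk_integral 1 (fun z => (cabs q.[z] ^+ 2)%R) +
   disk_integral 1 (fun z => (cabs h.[z] ^+ 2)%R))%E.
Proof.
move=> u1 lam1 qu hu; set I := disk_integral 1.
have sq0 (f : C -> C) z : 0 <= cabs (f z) ^+ 2 by exact: sqr_ge0.
have mp := @plane_measurable_horner_cabs2 R.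
have rot : I (fun z => (cabs (q + h).[z] ^+ 2)%R) = I (fun z => (cabs (q - h).[z] ^+ 2)%R).
  rewrite -[LHS](disk_integral_rotation 1 u _ u1 (mp _) (sq0 (horner (q + h)))).
  apply: eq_disk_integral => z; rewrite !hornerD hornerN qu hu mulNr -mulrBr.
  by rewrite cabsM lam1 mul1r.
have : (I (fun z => (cabs (q + h).[z] ^+ 2)%R) + I (fun z => (cabs (q - h).[z] ^+ 2)%R) =
        2%:E * (I (fun z => (cabs q.[z] ^+ 2)%R) + I (fun z => (cabs h.[z] ^+ 2)%R)))%E.
  rewrite -!(disk_integralD 1 _ _ (mp _) (mp _) (sq0 (horner _)) (sq0 (horner _))).
  rewrite -disk_integralZ//; last 2 first.
  - by apply: measurable_funD; exact: mp.
  - by move=> z; rewrite addr_ge0 ?sqr_ge0.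
  apply: eq_disk_integral => z.
  by rewrite !hornerD hornerN sqr_cabs_parallelogram mulrDr.
rewrite -rot -mule2n -mule_natl => /eqP.
by rewrite eq_le !lee_pmul2l// -eq_le => /eqP.
Qed.

Lemma horner_supported (c : C) u p :
  (forall j, p`_j != 0 -> u ^+ j = c) -> forall z, p.[u * z] = c * p.[z].
Proof.
move=> pj z; rewrite !horner_coef mulr_sumr; apply: eq_bigr => j _.
have [->|/pj uj] := eqVneq p`_j 0; first by rewrite !mul0r mulr0.
by rewrite exprMn uj mulrCA.
Qed.

(** By induction on [t], polynomials supported on a residue class modulo [2 ^ s]
    split into two classes modulo [2 ^ s.+1], which are orthogonal because of a
    rotation [u] with [u ^ (2 ^ s) = -1].  For [t = 0] only one monomial is left.
    Splitting in halves keeps all integrands nonnegative, so that no integrability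
    is at stake. *)
Lemma disk_integral_horner_supported s t c p : (size p <= 2 ^ (s + t))%N ->
  (forall j, p`_j != 0 -> (j %% 2 ^ s)%N = c) ->
  disk_integral 1 (fun z => cabs p.[z] ^+ 2) = (disk_area * coef_norm2 p)%:E.
Proof.
elim: t s c p => [|t IHt] s c p ps pc.
  rewrite addn0 in ps.
  have pE : p = p`_c *: 'X^c.
    apply/polyP => j; rewrite coefZ coefXn; have [<-|jc] := eqVneq c j.
      by rewrite mulr1.
    rewrite mulr0; apply/eqP/negPn/negP => pj.
    have := pc _ pj; rewrite modn_small => [/esym/eqP|]; first exact/negP.
    by apply: leq_trans ps; rewrite ltnNge; apply: contra pj => jp; rewrite nth_default.
  rewrite (@eq_disk_integral _ _ _ (fun z => cabs p`_c ^+ 2 * monomial2 c z)); last first.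
    by move=> z; rewrite {1}pE hornerZ hornerXn cabsM exprMn.
  rewrite disk_integralZ ?sqr_ge0//; first last.
  - by move=> z; exact: sqr_ge0.
  - exact: plane_measurable_monomial2.
  rewrite disk_integral_monomial2 -EFinM; congr (_%:E).
  rewrite (@coef_norm2E (maxn (size p) c.+1)) ?leq_maxl//.
  have cp : (c < maxn (size p) c.+1)%N by rewrite leq_max leqnn orbT.
  rewrite (bigD1 (Ordinal cp))//= big1 ?addr0; first by rewrite mulrCA.
  move=> j jc; suff -> : p`_j = 0 by rewrite cabs0 expr0n mul0r.
  move: jc; rewrite -(inj_eq val_inj) /= => jc.
  by move: (val j) jc => i ic; rewrite pE coefZ coefXn (negbTE ic) mulr0.
set m := (2 ^ s)%N in ps pc.
have m0 : (0 < m)%N by rewrite expn_gt0.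
have [u um u1] := @rootN1_exists R m m0.
pose part b := \poly_(j < size p) if odd (j %/ m)%N == b then p`_j else 0.
have partE b j : (part b)`_j = if odd (j %/ m)%N == b then p`_j else 0.
  rewrite coef_poly; case: ifPn => //; rewrite -leqNgt => jp.
  by rewrite nth_default// if_same.
have part0 b j : (part b)`_j != 0 -> [/\ odd (j %/ m)%N = b, (j %% m)%N = c & p`_j != 0].
  rewrite partE; case: (odd _ =P b) => [e p0|_]; last by rewrite eqxx.
  by split=> //; exact: (pc j p0).
have pE : p = part false + part true.
  apply/polyP => j; rewrite coefD !partE.
  by case: (odd _); rewrite /= ?add0r ?addr0.
have upow j : u ^+ j = (-1) ^+ (odd (j %/ m)%N) * u ^+ (j %% m)%N.
  by rewrite signr_odd {1}(divn_eq j m) exprD mulnC exprM um.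
have modE b j : (part b)`_j != 0 -> (j %% 2 ^ s.+1)%N = (b * m + c)%N.
  case/part0 => jb jc _; rewrite expnS -/m.
  have -> : j = ((j %/ m)./2 * (2 * m) + (b * m + c))%N.
    by rewrite [LHS](divn_eq j m) jc -{1}[(j %/ m)%N]odd_double_half jb; lia.
  have cm : (c < m)%N by rewrite -jc ltn_mod.
  rewrite modnMDl modn_small// mul2n -addnn.
  by case: (b); rewrite ?mul1n ?mul0n ?ltn_add2l// ltn_addr.
have sizeP b : (size (part b) <= 2 ^ (s.+1 + t))%N.
  by rewrite addSnnS (leq_trans (size_poly _ _)).
rewrite {1}pE (@disk_integral_orthogonal _ _ u (u ^+ c))//; first last.
- apply: horner_supported => j /part0[jb jc _].
  by rewrite upow jb jc expr1 mulN1r.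
- apply: horner_supported => j /part0[jb jc _].
  by rewrite upow jb jc expr0 mul1r.
- by rewrite cabsX u1 expr1n.
rewrite (IHt s.+1 _ _ (sizeP false) (modE false)).
rewrite (IHt s.+1 _ _ (sizeP true) (modE true)).
rewrite -EFinD -mulrDr; congr ((_ * _)%:E).
rewrite !(@coef_norm2E (size p)) ?size_poly// -big_split; apply: eq_bigr => j _.
rewrite !partE /= -mulrDl; congr (_ / _).
by case: (odd _); rewrite /= ?cabs0 expr0n ?add0r ?addr0.
Qed.

Lemma disk_integral_horner p :
  disk_integral 1 (fun z => cabs p.[z] ^+ 2) = (disk_area * coef_norm2 p)%:E.
Proof.
apply: (@disk_integral_horner_supported 0 (size p) 0) => [|j _].
  by rewrite ltnW// ltn_expl.
by rewrite expn0 modn1.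
Qed.

(** The squared norm of the constant function [1]. *)
Definition normalized_area : R := disk_area / pi.

Lemma normalized_area_ge0 : 0 <= normalized_area.
Proof. by rewrite divr_ge0 ?disk_area_ge0 ?pi_ge0. Qed.

Lemma sqr_bergman_norm (f : C -> C) : (bergman_norm f ^+ 2 =
  (pi^-1)%:E * disk_integral 1 (fun z => (cabs (f z) ^+ 2)%R))%E.
Proof.
rewrite /bergman_norm sqr_sqrte// mule_ge0//.
  by rewrite lee_fin invr_ge0 pi_ge0.
by apply: (disk_integral_ge0 1 (fun z => cabs (f z) ^+ 2)) => z; exact: sqr_ge0.
Qed.

Lemma sqr_bergman_norm_horner p :
  (bergman_norm (horner p) ^+ 2 = (normalized_area * coef_norm2 p)%:E)%E.
Proof.
by rewrite sqr_bergman_norm disk_integral_horner -EFinM mulrA (mulrC pi^-1).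
Qed.

End polynomial_norm2.

(** * Reproducing kernels on the diagonal *)
Section kernels.
Context {R : realType}.
Local Notation C := R[i].
Implicit Types (x t g : R) (l z : C).

Definition diag_kernel (n : nat) x : R := \sum_(j < n.+1) j.+1%:R * x ^+ j.

Lemma Re_bergman_kernel l :
  complex.Re (bergman_kernel l l) = (1 - cabs l ^+ 2) ^- 2.
Proof.
rewrite /bergman_kernel mulJ_cabs -(rmorph1 (real_complex R)) -rmorphB.
by rewrite -rmorphXn -fmorphV.
Qed.

Lemma Re_poly_kernel n l :
  complex.Re (poly_kernel n l l) = diag_kernel n (cabs l ^+ 2).
Proof.
rewrite /poly_kernel mulJ_cabs (_ : \sum_(_ < _) _ = (diag_kernel n (cabs l ^+ 2))%:C)//.
rewrite /diag_kernel rmorph_sum; apply: eq_bigr => j _.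
by rewrite [RHS]rmorphM [in RHS]rmorph_nat [in RHS]rmorphXn.
Qed.

Lemma diag_kernel_closed n x : diag_kernel n x * (1 - x) ^+ 2 =
  1 - x ^+ n.+1 * (1 + n.+1%:R * (1 - x)).
Proof.
elim: n => [|n IHn]; first by rewrite /diag_kernel big_ord1 /= expr0 expr1; ring.
rewrite /diag_kernel big_ord_recr /= mulrDl -/(diag_kernel n x) IHn.
rewrite [in RHS]exprS -[n.+2%:R]natr1; set y := x ^+ n.+1; set m : R := n.+1%:R.
ring.
Qed.

Lemma diag_kernel_gt0 n x : 0 <= x -> 0 < diag_kernel n x.
Proof.
move=> x0; rewrite /diag_kernel big_ord_recl expr0 mulr1 ltr_pwDl//.
by apply: sumr_ge0 => j _; rewrite mulr_ge0 ?exprn_ge0.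
Qed.

Lemma diag_kernel_le n x : 0 <= x -> x <= 1 -> diag_kernel n x * (1 - x) ^+ 2 <= 1.
Proof.
move=> x0 x1; rewrite diag_kernel_closed gerBl mulr_ge0 ?exprn_ge0//.
by rewrite addr_ge0// mulr_ge0// subr_ge0.
Qed.

Lemma expr1D_ge_quadratic t n : 0 <= t ->
  1 + n%:R * t + n%:R * (n%:R - 1) / 2 * t ^+ 2 <= (1 + t) ^+ n.
Proof.
move=> t0; elim: n => [|n IHn]; first by rewrite expr0; lra.
rewrite [leRHS]exprS; apply: (@le_trans _ _ ((1 + t) * (1 + n%:R * t + n%:R * (n%:R - 1) / 2 * t ^+ 2))).
  case: n {IHn} => [|n]; first by lra.
  rewrite -[n.+2%:R]natr1; set m : R := n.+1%:R.
  have m1 : 1 <= m by rewrite ler1n.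
  have : 0 <= m * (m - 1) / 2 * t ^+ 3.
    by rewrite mulr_ge0 ?exprn_ge0// divr_ge0// mulr_ge0// ?subr_ge0// (le_trans ler01).
  set e := m * (m - 1) / 2 * _ => e0.
  rewrite -subr_ge0 (_ : _ - _ = e)//; rewrite /e; field => //.
by rewrite ler_wpM2l ?addr_ge0.
Qed.

(** Write [N = n + 1], [t = 1 - x] and [u = N * t].  As [x <= 1 / (1 + t)] and
    [(1 + t) ^ N >= (1 + u / 2) ^ 2] for [N >= 2], the subtracted term of the
    closed form is at most [(1 + u) / (1 + u / 2) ^ 2]. *)
Lemma diag_kernel_ge n x g : (0 < n)%N -> 0 <= x -> x <= 1 -> 0 < g ->
  g <= n.+1%:R * (1 - x) -> (g / (2 + g)) ^+ 2 <= diag_kernel n x * (1 - x) ^+ 2.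
Proof.
move=> n0 x0 x1 g0; rewrite diag_kernel_closed.
set t := 1 - x; set u := n.+1%:R * t => gu.
have t0 : 0 <= t by rewrite subr_ge0.
have up : (1 + u / 2) ^+ 2 <= (1 + t) ^+ n.+1.
  apply: le_trans (expr1D_ge_quadratic t n.+1 t0).
  have n2 : 2 <= n.+1%:R :> R by rewrite ler_nat ltnS.
  rewrite -subr_ge0 /u; set m : R := n.+1%:R in n2 *.
  rewrite (_ : _ - _ = m * (m - 2) / 4 * t ^+ 2); last by field.
  by rewrite mulr_ge0 ?sqr_ge0// divr_ge0// mulr_ge0 ?subr_ge0// (le_trans _ n2).
have xt : x ^+ n.+1 * (1 + t) ^+ n.+1 <= 1.
  rewrite -exprMn exprn_ile1 ?mulr_ge0//; first by apply: addr_ge0.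
  by rewrite /t; have := sqr_ge0 (1 - x); nra.
set y := x ^+ n.+1 in xt *.
have y0 : 0 <= y by rewrite exprn_ge0.
have yu : y * (1 + u / 2) ^+ 2 <= 1 by apply: le_trans xt; rewrite ler_wpM2l.
have u0 : 0 < u by exact: lt_le_trans gu.
have h1 : (g / (2 + g)) ^+ 2 <= (u / (2 + u)) ^+ 2.
  have g2 : 0 < 2 + g by lra.
  have u2 : 0 < 2 + u by lra.
  have gu2 : g / (2 + g) <= u / (2 + u).
    by rewrite ler_pdivrMr// mulrAC ler_pdivlMr//; lra.
  by rewrite lerXn2r// nnegrE divr_ge0// ltW.
apply: le_trans h1 _; rewrite lerBrDr -lerBrDl.
have -> : 1 - (u / (2 + u)) ^+ 2 = (1 + u) / (1 + u / 2) ^+ 2.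
  by field; rewrite !gt_eqF//; lra.
have v0 : 0 < (1 + u / 2) ^+ 2 by rewrite exprn_gt0//; lra.
by rewrite ler_pdivlMr//; nra.
Qed.

End kernels.

(** * Sums over arbitrary sets *)
Section finite_sums.
Context {R : realType} {T : choiceType}.
Implicit Types (S : set T) (a : T -> R) (K : R).

(** Sums of nonnegative reals over arbitrary sets are handled through their
    finite partial sums, indexed by duplicate-free sequences. *)
Lemma esum_leP S a K : (forall i, 0 <= a i) ->
  (\esum_(i in S) (a i)%:E <= K%:E)%E <->
  (forall s : seq T, uniq s -> [set` s] `<=` S -> \sum_(i <- s) a i <= K).
Proof.
move=> a0; split=> [SK s us sS|H].
  rewrite -lee_fin; apply: le_trans SK; rewrite -sumEFin.
  rewrite (fsbig_seq _ _ us); apply: esum_ge; exists [set` s] => //.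
rewrite ge_ereal_sup//= => _ [F [Ffin FS] <-].
rewrite fsbig_finite//= sumEFin lee_fin; apply: H; first exact: finmap.fset_uniq.
by move=> i /=; rewrite in_fset_set// inE => /FS.
Qed.

Lemma finite_set_of_sum_bound S a K c : (forall i, 0 <= a i) -> 0 < c ->
  (forall i, S i -> c <= a i) ->
  (\esum_(i in S) (a i)%:E <= K%:E)%E -> finite_set S.
Proof.
move=> a0 c0 ca /(esum_leP _ _ _ a0) H; apply: contrapT => Sinf.
have [F FS Fn] := infinite_set_fset (Num.bound `|K / c|) Sinf.
have := H _ (finmap.fset_uniq F) FS; apply/negP; rewrite -ltNge.
apply: (@lt_le_trans _ _ (\sum_(i <- finmap.enum_fset F) c)).
  rewrite big_const_seq count_predT iter_addr_0 -mulr_natr mulrC -ltr_pdivrMr//.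
  apply: le_lt_trans (ler_norm _) _.
  by apply: lt_le_trans (archi_boundP (normr_ge0 _)) _; rewrite ler_nat.
by rewrite big_seq [leRHS]big_seq; apply: ler_sum => i /FS; exact: ca.
Qed.

End finite_sums.

(** * Local power series *)
Section taylor.
Context {R : realType}.
Local Notation C := R[i].
Implicit Types (a b : nat -> C) (f g : C -> C) (z w : C) (r d : R).

Definition psum a w (n : nat) : C := \sum_(k < n) a k * w ^+ k.

Definition taylor_at a f z0 : Prop := exists2 d : R, 0 < d &
  forall z, cabs (z - z0) < d -> cabs (psum a (z - z0) n - f z) @[n --> \oo] --> (0 : R).

Definition taylor_poly a n : {poly C} := \poly_(k < n) a k.

Lemma psum_horner a w n : psum a w n = (taylor_poly a n).[w].
Proof. by rewrite horner_poly. Qed.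

Lemma near_complexP z0 (P : set C) :
  (\forall z \near (z0 : C^o), P z) <->
  (exists2 d : R, 0 < d & forall z, cabs (z - z0) < d -> P z).
Proof.
split=> [/nbhs_ballP[e e0 eP]|[d d0 dP]]; last apply/nbhs_ballP.
  have := e0; rewrite /= ltcE /= => /andP[/eqP ei er].
  exists (complex.Re e) => // z zd; apply: eP; rewrite /ball /= -normrN opprB.
  by rewrite normC_cabs ltcE /= ei eqxx.
exists d%:C; first by rewrite /= ltcR.
move=> z; rewrite /ball /= -normrN opprB normC_cabs => zd; apply: dP.
by rewrite -ltcR.
Qed.

Lemma cvg_complexP (u : nat -> C) (s : C) :
  (u n : C^o) @[n --> \oo] --> (s : C^o) <->
  cabs (u n - s) @[n --> \oo] --> (0 : R).
Proof.
split=> [/cvgrPdist_lt H|/cvgrPdist_lt H]; apply/cvgrPdist_lt => e e0.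
  have := H e%:C; rewrite ltcR => /(_ e0); apply: filterS => n.
  rewrite -normrN opprB normC_cabs ltcR sub0r normrN ger0_norm ?cabs_ge0//.
have := e0; rewrite ltcE /= => /andP[/eqP ei er].
have := H _ er; apply: filterS => n; rewrite sub0r normrN ger0_norm ?cabs_ge0// => h.
by rewrite -normrN opprB normC_cabs ltcE /= ei eqxx.
Qed.

Lemma analytic_onP (D : set C) f :
  analytic_on D f <-> (forall z0, D z0 -> exists a, taylor_at a f z0).
Proof.
have E a z z0 : series (fun k => a k * (z - z0) ^+ k : C^o) = psum a (z - z0).
  by apply/funext => n; rewrite /psum /series /= big_mkord.
split=> H z0 /H[a].
  move/near_complexP => [d d0 dP]; exists a, d => // z /dP.
  by rewrite E => /cvg_complexP.
move=> [d d0 dP]; exists a; apply/near_complexP; exists d => // z /dP.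
by rewrite E => /cvg_complexP.
Qed.

Lemma psum_at0 a n : psum a 0 n.+1 = a 0.
Proof.
rewrite /psum big_ord_recl expr0 mulr1 big1 ?addr0// => i _.
by rewrite expr0n /= mulr0.
Qed.

Lemma taylor_at0 a f z0 : taylor_at a f z0 -> f z0 = a 0.
Proof.
move=> [d d0 /(_ z0)]; rewrite subrr cabs0 => /(_ d0) H.
apply/eqP; rewrite eq_sym -subr_eq0 -cabs_eq0; apply/eqP.
apply: (@cvg_unique _ (@Rhausdorff R)) H => //.
apply: cvg_near_cst; near=> n; have n0 : (0 < n)%N by near: n; exact: nbhs_infty_gt.
by rewrite -(prednK n0) psum_at0.
Unshelve. all: by end_near. Qed.

Lemma taylor_atD a b f g z0 : taylor_at a f z0 -> taylor_at b g z0 ->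
  taylor_at (fun k => a k + b k) (fun z => f z + g z) z0.
Proof.
move=> [d d0 fa] [e e0 gb]; exists (Num.min d e); first by rewrite lt_min d0.
move=> z; rewrite lt_min => /andP[/fa {}fa /gb {}gb].
apply: (@squeeze_cvgr _ _ _ _ (fun=> 0) (fun n => cabs (psum a (z - z0) n - f z) + cabs (psum b (z - z0) n - g z))).
- near=> n; rewrite cabs_ge0 /=; apply: le_trans (ler_cabsD _ _).
  rewrite /psum (eq_bigr (fun k : 'I_n => a k * (z - z0) ^+ k + b k * (z - z0) ^+ k)) => [|k _]; last exact: mulrDl.
  by rewrite big_split /= opprD addrACA.
- exact: cvg_cst.
- by rewrite -[X in _ --> X](addr0 0); exact: cvgD.
Unshelve. all: by end_near. Qed.

Lemma taylor_atZ c a f z0 : taylor_at a f z0 ->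
  taylor_at (fun k => c * a k) (fun z => c * f z) z0.
Proof.
move=> [d d0 fa]; exists d => // z /fa {}fa.
rewrite (_ : (fun n => _) = (fun n => cabs c * cabs (psum a (z - z0) n - f z))).
  by rewrite -[X in _ --> X](mulr0 (cabs c)); apply: cvgM => //; exact: cvg_cst.
apply/funext => n; rewrite -cabsM mulrBr; congr (cabs (_ - _)).
by rewrite /psum mulr_sumr; apply: eq_bigr => k _; rewrite mulrA.
Qed.

Lemma taylor_at_rotation u a f z0 : cabs u = 1 -> taylor_at a f (u * z0) ->
  taylor_at (fun k => u ^+ k * a k) (fun z => f (u * z)) z0.
Proof.
move=> u1 [d d0 fa]; exists d => // z zd.
have := fa (u * z); rewrite -mulrBr cabsM u1 mul1r => /(_ zd).
apply: cvg_trans; apply: near_eq_cvg; near=> n; congr (cabs (_ - _)).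
by apply: eq_bigr => k _; rewrite exprMn mulrA (mulrC (a k)).
Unshelve. all: by end_near. Qed.

Lemma taylor_at_horner (p : {poly C}) z0 :
  taylor_at (fun k => (p \Po ('X + z0%:P))`_k) (horner p) z0.
Proof.
exists 1 => // z _; set q := p \Po _.
apply: cvg_near_cst; near=> n.
have nq : (size q <= n)%N by near: n; exact: nbhs_infty_ge.
apply/eqP; rewrite cabs_eq0 subr_eq0; apply/eqP.
have -> : p.[z] = q.[z - z0] by rewrite horner_comp hornerD hornerX hornerC subrK.
by rewrite (horner_coef_wide _ nq).
Unshelve. all: by end_near. Qed.

Lemma analytic_horner (D : set C) (p : {poly C}) : analytic_on D (horner p).
Proof. by apply/analytic_onP => z0 _; eexists; exact: taylor_at_horner. Qed.

(** Convergence at one point other than the centre bounds the coefficients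
    geometrically. *)
Lemma taylor_at_bound a f z0 : taylor_at a f z0 ->
  exists s M : R, [/\ 0 < s, 0 < M & forall k, cabs (a k) * s ^+ k <= M].
Proof.
move=> [d d0 fa]; pose s := d / 2; have s0 : 0 < s by rewrite divr_gt0.
have := fa (z0 + s%:C); rewrite addrC addKr cabsR gtr0_norm//.
rewrite /s ltr_pdivrMr// mulr2n mulrDr mulr1 ltrDl -/s => /(_ d0).
set y := f _ => cv.
have [B [_ B0]] := cvg_seq_bounded (cvgP _ cv).
pose M := `|B| + 1; have BM : B < M by rewrite (le_lt_trans (ler_norm _))// ltrDl.
exists s, (M + M); split => // [|k].
  by rewrite addr_gt0// ltr_wpDl.
have H n : cabs (psum a s%:C n - y) <= M.
  by have := B0 _ BM n I; rewrite /= ger0_norm ?cabs_ge0.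
have -> : cabs (a k) * s ^+ k = cabs ((psum a s%:C k.+1 - y) - (psum a s%:C k - y)).
  rewrite opprB addrA subrK /psum big_ord_recr /= addrAC subrr add0r.
  by rewrite cabsM cabsX cabsR gtr0_norm.
by apply: le_trans (ler_cabsB _ _) _; rewrite lerD.
Qed.

(** The coefficients are at most [M / s ^ k]; for [|w| <= s / 2] a geometric series
    of ratio at most [1 / 2] dominates the remainder. *)
Lemma taylor_remainder a f z0 m : taylor_at a f z0 ->
  exists K d : R, [/\ 0 <= K, 0 < d & forall z, cabs (z - z0) < d ->
    cabs (f z - psum a (z - z0) m) <= K * cabs (z - z0) ^+ m].
Proof.
move=> fa; have [s [M [s0 M0 Ma]]] := taylor_at_bound _ _ _ fa.
case: fa => d d0 fa.
exists (2 * M / s ^+ m), (Num.min d (s / 2)); split.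
- by rewrite divr_ge0 ?exprn_ge0 ?mulr_ge0 ?ltW.
- by rewrite lt_min d0 divr_gt0.
move=> z; rewrite lt_min => /andP[/fa {}fa]; set w := z - z0 in fa *.
move=> ws; pose q := cabs w / s.
have q0 : 0 <= q by rewrite divr_ge0 ?cabs_ge0 ?ltW.
have q2 : q <= 2^-1 by rewrite ler_pdivrMr// mulrC ltW.
have head n : cabs (psum a w (m + n) - psum a w m) <= M * q ^+ m * (2 - 2 * q ^+ n).
  elim: n => [|n IHn]; first by rewrite addn0 subrr cabs0 expr0 mulr1 subrr mulr0.
  rewrite addnS [psum a w (m + n).+1]big_ord_recr /= -/(psum a w (m + n)).
  rewrite addrAC; apply: le_trans (ler_cabsD _ _) _.
  apply: le_trans (lerD IHn (_ : _ <= M * q ^+ m * q ^+ n)) _.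
    rewrite cabsM cabsX -mulrA -exprD /q expr_div_n mulrA ler_pdivlMr ?exprn_gt0//.
    by rewrite mulrAC ler_wpM2r ?exprn_ge0 ?cabs_ge0.
  rewrite -mulrDr ler_wpM2l ?mulr_ge0 ?exprn_ge0 ?(ltW M0)// exprS.
  by have := exprn_ge0 n q0; set v := q ^+ n => v0; nra.
have {}head n : cabs (psum a w (m + n) - psum a w m) <= 2 * M / s ^+ m * cabs w ^+ m.
  apply: le_trans (head n) _.
  have -> : 2 * M / s ^+ m * cabs w ^+ m = M * q ^+ m * 2.
    by rewrite /q expr_div_n; ring.
  by rewrite ler_wpM2l ?mulr_ge0 ?exprn_ge0 ?(ltW M0)// gerBl mulr_ge0 ?exprn_ge0.
apply/ler_addgt0Pr => e e0.
have [N _ NP] : \forall n \near \oo, cabs (psum a w n - f z) < e by exact: cvgr_lt fa _ e0.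
have := NP (m + N)%N (leq_addl _ _) => eN.
rewrite -(subrK (psum a w (m + N)) (f z)) -addrA.
apply: le_trans (ler_cabsD _ _) _; rewrite [leLHS]addrC lerD//.
by rewrite cabsB ltW.
Qed.

End taylor.

(** * From sampling sets to Marcinkiewicz-Zygmund families *)
Section samples.
Context {R : realType}.
Local Notation C := R[i].
Local Notation W := (@normalized_area R).
Implicit Types (f : C -> C) (p : {poly C}) (l z : C) (L : set C).

Definition sample f l : R := cabs (f l) ^+ 2 * (1 - cabs l ^+ 2) ^+ 2.

Definition poly_sample (n : nat) f l : R :=
  cabs (f l) ^+ 2 / diag_kernel n (cabs l ^+ 2).

Lemma sampleE f l :
  cabs (f l) ^+ 2 / complex.Re (bergman_kernel l l) = sample f l.
Proof. by rewrite Re_bergman_kernel invrK. Qed.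

Lemma poly_sampleE n f l :
  cabs (f l) ^+ 2 / complex.Re (poly_kernel n l l) = poly_sample n f l.
Proof. by rewrite Re_poly_kernel. Qed.

Lemma sample_ge0 f l : 0 <= sample f l.
Proof. by rewrite mulr_ge0 ?sqr_ge0. Qed.

Lemma poly_sample_ge0 n f l : 0 <= poly_sample n f l.
Proof. by rewrite divr_ge0 ?sqr_ge0// ltW// diag_kernel_gt0 ?sqr_ge0. Qed.

Lemma cabs2_lt1 l : cabs l < 1 -> cabs l ^+ 2 < 1.
Proof. by move=> l1; rewrite expr_lt1 ?cabs_ge0. Qed.

Lemma sample_le_poly_sample n f l : cabs l < 1 -> sample f l <= poly_sample n f l.
Proof.
move=> l1; rewrite /sample /poly_sample ler_wpM2l ?sqr_ge0//.
have k0 := diag_kernel_gt0 n _ (sqr_ge0 (cabs l)).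
rewrite -(ler_pM2l k0) divff ?gt_eqF//.
by rewrite diag_kernel_le ?sqr_ge0// ltW// cabs2_lt1.
Qed.

Lemma poly_sample_le_sample n f l g : (0 < n)%N -> cabs l < 1 -> 0 < g ->
  g <= n.+1%:R * (1 - cabs l) ->
  (g / (2 + g)) ^+ 2 * poly_sample n f l <= sample f l.
Proof.
move=> n0 l1 g0 gl; rewrite /sample /poly_sample mulrCA ler_wpM2l ?sqr_ge0//.
have k0 := diag_kernel_gt0 n _ (sqr_ge0 (cabs l)).
rewrite ler_pdivrMr//.
have l2 := cabs2_lt1 _ l1.
rewrite [leRHS]mulrC; apply: diag_kernel_ge; rewrite ?sqr_ge0//; first exact: ltW.
apply: le_trans gl _; rewrite ler_wpM2l// lerB// expr2 ler_piMr ?cabs_ge0//; exact: ltW.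
Qed.

Lemma bergman_norm_lty f :
  (bergman_norm f ^+ 2 < +oo)%E -> (bergman_norm f < +oo)%E.
Proof. by case: (bergman_norm f) => [r||]//; rewrite ?ltry// expe2 mulyy. Qed.

Lemma bergman_space_horner p : bergman_space (horner p).
Proof.
split; first exact: analytic_horner.
by apply: bergman_norm_lty; rewrite sqr_bergman_norm_horner ltry.
Qed.

Lemma coef_norm2_1 : coef_norm2 (1 : {poly C}) = 1.
Proof. by rewrite /coef_norm2 size_poly1 big_ord1 coef1 cabs1 expr1n divr1. Qed.

(** Multiplication by [z ^ m] replaces the weight [1 / (j + 1)] by
    [1 / (j + m + 1)], and [(K + 1) * (j + 1) <= j + m + 1] for [j < size p]. *)
Lemma coef_norm2_XnM p m K : (size p * K <= m)%N ->
  K.+1%:R * coef_norm2 ('X^m * p) <= coef_norm2 p.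
Proof.
move=> pm; rewrite (@coef_norm2E _ (m + size p)); last first.
  by apply: leq_trans (size_polyMleq _ _) _; rewrite size_polyXn.
rewrite big_split_ord /= big1 ?add0r => [|j _]; last first.
  by rewrite coefXnM ltn_ord cabs0 expr0n mul0r.
rewrite /coef_norm2 mulr_sumr; apply: ler_sum => j _.
rewrite coefXnM ltnNge leq_addr /= addKn mulrCA ler_wpM2l ?sqr_ge0//.
rewrite ler_pdivrMr ?ltr0n// mulrC ler_pdivlMr ?ltr0n// -natrM ler_nat.
have : (j.+1 * K <= m)%N by apply: leq_trans pm; rewrite leq_mul2r ltn_ord orbT.
by rewrite mulSn mulSn mulnS; lia.
Qed.

Lemma bernoulli (t : R) n : 0 <= t -> t <= 1 -> 1 - n%:R * t <= (1 - t) ^+ n.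
Proof.
move=> t0 t1; elim: n => [|n IHn]; first by rewrite mul0r subr0 expr0.
have h : 0 <= n%:R * t by rewrite mulr_ge0.
rewrite exprS -natr1; apply: le_trans (_ : (1 - t) * (1 - n%:R * t) <= _).
  by rewrite -subr_ge0 (_ : _ - _ = t * (n%:R * t)) ?mulr_ge0//; ring.
by rewrite ler_wpM2l ?subr_ge0.
Qed.

(** The sampling inequalities for polynomials only, with their norms expressed by
    coefficients. *)
Definition sampling_bounds L (A B : R) := forall p,
  ((A * (W * coef_norm2 p))%:E <= \esum_(l in L) (sample (horner p) l)%:E)%E /\
  (\esum_(l in L) (sample (horner p) l)%:E <= (B * (W * coef_norm2 p))%:E)%E.

Lemma sampling_set_bounds L : sampling_set L ->
  L `<=` @unit_disk R /\
  exists A B : R, [/\ 0 < A, 0 < B & sampling_bounds L A B].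
Proof.
move=> [LD [A [B [A0 B0 H]]]]; split=> //; exists A, B; split=> // p.
have := H _ (bergman_space_horner p); rewrite sqr_bergman_norm_horner -!EFinM.
by under eq_esum do rewrite sampleE.
Qed.

(** The Bessel inequality for [z ^ m * p] controls the samples of [p] near the
    unit circle: with [m = (n + 1) * K], the squared norm of [z ^ m * p] is at most
    that of [p] divided by [K + 1], while [|z ^ m| ^ 2] is still at least [1 / 2]
    where [|z| >= 1 - g / n]. *)
Lemma sampling_tail L A B n K g p : (0 < n)%N -> (size p <= n.+1)%N ->
  0 < g -> 8 * K%:R * g <= 1 ->  g <= 1 -> 0 < B -> sampling_bounds L A B ->
  forall s : seq C, uniq s -> [set` s] `<=` L `&` ~` (open_disk0 (1 - g / n%:R)) ->
    [set` s] `<=` @unit_disk R ->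
  K.+1%:R * \sum_(l <- s) sample (horner p) l <= 2 * B * (W * coef_norm2 p).
Proof.
move=> n0 pn g0 Kg g1 B0 LB s us sL sD; set m := (n.+1 * K)%N.
have [_ /(esum_leP _ _ _ (sample_ge0 _))/(_ s us)] := LB ('X^m * p).
have sL' : [set` s] `<=` L by move=> i /sL[].
move=> /(_ sL') SB.
have t1 : g / n%:R <= 1 by rewrite ler_pdivrMr ?ltr0n// mul1r (le_trans g1)// ler1n.
have t0 : 0 <= g / n%:R by rewrite divr_ge0// ltW.
have half : 2^-1 <= (1 - g / n%:R) ^+ (2 * m).
  apply: le_trans (bernoulli _ _ t0 t1).
  have -> : (2 * m)%:R * (g / n%:R) = 2 * K%:R * g * (n.+1%:R / n%:R).
    by rewrite /m !natrM; ring.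
  have n12 : n.+1%:R / n%:R <= 2 :> R.
    by rewrite ler_pdivrMr ?ltr0n// -natrM ler_nat; lia.
  have Kg0 : 0 <= 2 * K%:R * g by rewrite !mulr_ge0// ltW.
  have := ler_wpM2l Kg0 n12; lra.
have comp l : l \in s -> sample (horner p) l <= 2 * sample (horner ('X^m * p)) l.
  move=> ls; have l1 : cabs l < 1 by exact: sD.
  have lr : 1 - g / n%:R <= cabs l.
    by rewrite leNgt; apply/negP => lr; case: (sL l ls) => _; exact.
  have lm : 2^-1 <= cabs l ^+ (2 * m).
    by apply: le_trans half _; rewrite lerXn2r ?nnegrE ?cabs_ge0// subr_ge0.
  have -> : sample (horner ('X^m * p)) l = cabs l ^+ (2 * m) * sample (horner p) l.
    by rewrite /sample hornerM hornerXn cabsM cabsX exprMn -exprM mulnC mulrA.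
  by rewrite mulrA ler_peMl ?sample_ge0//; lra.
have {}comp : \sum_(l <- s) sample (horner p) l <= 2 * \sum_(l <- s) sample (horner ('X^m * p)) l.
  by rewrite mulr_sumr big_seq [leRHS]big_seq; exact: ler_sum.
apply: le_trans (ler_wpM2l (ler0n _ _) comp) _.
rewrite mulrCA -mulrA ler_wpM2l//.
apply: le_trans (ler_wpM2l (ler0n _ K.+1) SB) _.
rewrite mulrCA ler_wpM2l ?(ltW B0)// mulrCA ler_wpM2l ?normalized_area_ge0//.
by apply: coef_norm2_XnM; rewrite leq_mul2r pn orbT.
Qed.

Lemma MZ_of_sampling L : sampling_set L ->
  exists g0 : R, 0 < g0 /\ forall g : R, 0 < g -> g < g0 ->
    MZ_family (fun n => L `&` open_disk0 (1 - g / n%:R)).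
Proof.
move=> /sampling_set_bounds[LD [A [B [A0 B0 LB]]]].
(* [K] makes the tail [2 * B / (K + 1)] at most half of the lower constant *)
pose K := Num.bound (4 * B / A).
have KA : 4 * B <= A * K.+1%:R.
  have BA0 : 0 <= 4 * B / A by rewrite divr_ge0 ?mulr_ge0 // ltW.
  rewrite [leRHS]mulrC -ler_pdivrMr// (le_trans (ltW (archi_boundP BA0)))//.
  by rewrite ler_nat.
exists (8 * K%:R + 1)^-1; split=> [|g gpos gK]; first by rewrite invr_gt0 ltr_wpDl.
have gK1 : (8 * K%:R + 1) * g < 1.
  by rewrite mulrC -ltr_pdivlMr ?ltr_wpDl// div1r.
have Kg : 8 * K%:R * g <= 1 by lra.
have g1 : g <= 1.
  have : 0 <= 8 * K%:R * g by rewrite !mulr_ge0// ltW.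
  by lra.
have inD n l : open_disk0 (1 - g / n%:R) l -> cabs l < 1 by case.
have LnL n : L `&` open_disk0 (1 - g / n%:R) `<=` L by exact: subIsetl.
have gap n l : (0 < n)%N -> open_disk0 (1 - g / n%:R) l -> g / n%:R <= 1 - cabs l.
  by move=> n0 [_ ln]; rewrite lerBrDr -lerBrDl ltW.
have fin n : (0 < n)%N -> finite_set (L `&` open_disk0 (1 - g / n%:R)).
  move=> n0; apply: (@finite_set_of_sum_bound _ _ _ (sample (horner 1)) (B * (W * 1)) ((g / n%:R) ^+ 2)).
  - exact: sample_ge0.
  - by rewrite exprn_gt0// divr_gt0// ltr0n.
  - move=> l [_ ln]; rewrite /sample hornerC cabs1 expr1n mul1r.
    have h := gap _ _ n0 ln; have := inD _ _ ln; have := cabs_ge0 l => c0 c1.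
    rewrite lerXn2r ?nnegrE ?divr_ge0 ?(ltW gpos)//; nra.
  - apply/(esum_leP _ _ _ (sample_ge0 _)) => s us sL.
    have [_ /(esum_leP _ _ _ (sample_ge0 _))/(_ s us)] := LB 1.
    by rewrite coef_norm2_1; apply; apply: subset_trans (LnL n).
split=> [n n0|]; first by split; [exact: fin|move=> l [_ []]].
pose c := (g / (2 + g)) ^+ 2.
have c0 : 0 < c by rewrite exprn_gt0// divr_gt0// addr_gt0.
exists (A / 2), (B / c), 1%N; split=> [|||n n0 p pn]; rewrite ?divr_gt0//.
set Ln := L `&` _; have Lfin : finite_set Ln by exact: fin.
rewrite !sqr_bergman_norm_horner -!EFinM.
under eq_fsbigr do rewrite poly_sampleE.
rewrite -(esum_fset Lfin); last by move=> l _; rewrite lee_fin poly_sample_ge0.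
split; last first.
  apply/(esum_leP _ _ _ (poly_sample_ge0 _ _)) => s us sL.
  have [_ /(esum_leP _ _ _ (sample_ge0 _))/(_ s us)] := LB p.
  move=> /(_ (subset_trans sL (LnL n))) SB.
  rewrite mulrAC ler_pdivlMr//; apply: le_trans SB.
  rewrite mulr_suml big_seq [leRHS]big_seq; apply: ler_sum => l /sL[_ ln].
  rewrite mulrC poly_sample_le_sample// ?(inD _ _ ln)//.
  have h := gap _ _ n0 ln.
  apply: le_trans (_ : n.+1%:R * (g / n%:R) <= _); last by rewrite ler_wpM2l.
  rewrite mulrA ler_pdivlMr ?ltr0n// mulrC ler_wpM2r ?(ltW gpos)// ler_nat//.
have [+ _] := LB p; rewrite (esumID (open_disk0 (1 - g / n%:R))); last first.
  by move=> l _; rewrite lee_fin sample_ge0.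
rewrite -/Ln => low.
have tail : (\esum_(l in L `&` ~` open_disk0 (1 - g / n%:R)) (sample (horner p) l)%:E
    <= (A / 2 * (W * coef_norm2 p))%:E)%E.
  apply/(esum_leP _ _ _ (sample_ge0 _)) => s us sL.
  have := @sampling_tail L A B n K g p n0 pn gpos Kg g1 B0 LB s us sL.
  move=> /(_ (fun l ls => LD _ (proj1 (sL l ls)))); set S := \sum_(_ <- _) _ => SB.
  have N0 : 0 <= W * coef_norm2 p.
    by rewrite mulr_ge0 ?normalized_area_ge0 ?coef_norm2_ge0.
  rewrite -(ler_pM2l (ltr0Sn _ K)); apply: le_trans SB _.
  by rewrite [leRHS]mulrA ler_wpM2r//; lra.
have : ((A * (W * coef_norm2 p))%:E <= \esum_(l in Ln) (poly_sample n (horner p) l)%:E +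
   (A / 2 * (W * coef_norm2 p))%:E)%E.
  apply: le_trans low _; apply: leeD tail; apply: le_esum => l [_ [l1 _]].
  by rewrite lee_fin sample_le_poly_sample.
rewrite -leeBlDr//; apply: le_trans; rewrite -EFinB lee_fin; lra.
Qed.

End samples.

(** * Division by a power of z *)
Section global_taylor.
Context {R : realType}.
Local Notation C := R[i].
Local Notation D := (@unit_disk R).
Implicit Types (a b : nat -> C) (f g : C -> C) (z w : C) (r d : R).

Lemma psumS_shift a w n :
  psum a w n.+1 = a 0 + w * psum (fun k => a k.+1) w n.
Proof.
rewrite /psum big_ord_recl expr0 mulr1 mulr_sumr; congr (_ + _).
by apply: eq_bigr => k _; rewrite /bump /= exprS mulrCA.
Qed.

Lemma cvg0Ml (u : nat -> R) (c : R) : u n @[n --> \oo] --> (0 : R) ->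
  c * u n @[n --> \oo] --> (0 : R).
Proof. by move=> u0; rewrite -[X in _ --> X](mulr0 c); apply: cvgM u0; exact: cvg_cst. Qed.

(** Division by [z] at the origin shifts the coefficients. *)
Lemma taylor_at_div0 a f g : taylor_at a f 0 -> g 0 = a 1 -> a 0 = 0 ->
  (forall z, z != 0 -> f z = z * g z) -> taylor_at (fun k => a k.+1) g 0.
Proof.
move=> [d d0 fa] g0 a0 fg; exists d => // z zd.
have [->|z0] := eqVneq z 0.
  rewrite subr0; apply: cvg_near_cst; near=> n.
  have n0 : (0 < n)%N by near: n; exact: nbhs_infty_gt.
  by rewrite -(prednK n0) psum_at0 g0 subrr cabs0.
have := fa z zd; rewrite -(cvg_shiftS (fun n => cabs (psum a (z - 0) n - f z))).
move=> /(cvg0Ml _ (cabs z)^-1).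
apply: cvg_trans; apply: near_eq_cvg; near=> n; rewrite subr0.
by rewrite psumS_shift a0 add0r fg// -mulrBr cabsM mulKf// cabs_eq0.
Unshelve. all: by end_near. Qed.

(** The coefficients of [f z / z] at [z0 != 0] solve
    [(z0 + w) * (b 0 + b 1 * w + ...) = a 0 + a 1 * w + ...]. *)
Fixpoint div_coef (z0 : C) a (k : nat) : C :=
  (a k - if k is k'.+1 then div_coef z0 a k' else 0) / z0.

(** If [|a k| <= M / s ^ k] with [s <= |z0| / 2], the recursion
    [b k = (a k - b (k - 1)) / z0] preserves [|b k| * s ^ k <= 2 * M / |z0|]. *)
Lemma div_coef_bound z0 a s M : z0 != 0 -> 0 < s -> s <= cabs z0 / 2 ->
  (forall k, cabs (a k) * s ^+ k <= M) ->
  forall k, cabs (div_coef z0 a k) * s ^+ k <= 2 * M / cabs z0.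
Proof.
rewrite -cabs_gt0; move: (cabs z0) (@cabsV R z0) => c cV c0 s0 sc aM.
have M0 : 0 <= M.
  by apply: le_trans (aM 0); rewrite expr0 mulr1 cabs_ge0.
elim=> [|k IHk] /=.
  rewrite subr0 cabsM cV mulrAC ler_pdivrMr// divfK ?gt_eqF//.
  by apply: le_trans (aM 0) _; lra.
rewrite cabsM cV mulrAC ler_pdivrMr// divfK ?gt_eqF//.
apply: le_trans (_ : (cabs (a k.+1) + cabs (div_coef z0 a k)) * s ^+ k.+1 <= _).
  by rewrite ler_wpM2r ?exprn_ge0 ?(ltW s0)// ler_cabsB.
rewrite mulrDl (_ : 2 * M = M + M); last by ring.
apply: lerD (aM _) _; rewrite exprSr mulrA.
apply: le_trans (ler_pM _ (ltW s0) IHk sc) _.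
  by rewrite mulr_ge0 ?cabs_ge0 ?exprn_ge0 ?(ltW s0).
by rewrite (_ : _ * (c / 2) = M)//; field; rewrite gt_eqF.
Qed.

Lemma psum_div_coef z0 a w n : z0 != 0 ->
  (z0 + w) * psum (div_coef z0 a) w n.+1 = psum a w n.+1 + div_coef z0 a n * w ^+ n.+1.
Proof.
move=> z00; elim: n => [|n IHn].
  by rewrite /psum !big_ord1 /= subr0 !expr0 expr1 !mulr1; field.
rewrite /psum big_ord_recr /= -/(psum _ w n.+1) mulrDr IHn.
rewrite [in RHS]big_ord_recr /= -/(psum a w n.+1) -!addrA; congr (_ + _).
rewrite -/(div_coef z0 a n) [w ^+ n.+2]exprS; set y := w ^+ n.+1.
by field.
Qed.

Lemma taylor_at_div a f g z0 : z0 != 0 -> taylor_at a f z0 ->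
  (forall z, z != 0 -> f z = z * g z) -> taylor_at (div_coef z0 a) g z0.
Proof.
move=> z00 fa fg; have [s [M [s0 M0 aM]]] := taylor_at_bound _ _ _ fa.
case: fa => d d0 fa; have c0 : 0 < cabs z0 by rewrite cabs_gt0.
pose t := Num.min s (cabs z0 / 2).
have t0 : 0 < t by rewrite lt_min s0 divr_gt0.
have aMt k : cabs (a k) * t ^+ k <= M.
  apply: le_trans (aM k); rewrite ler_wpM2l ?cabs_ge0// lerXn2r ?nnegrE ?(ltW s0) ?(ltW t0)//.
  by rewrite ge_min lexx.
have tc : t <= cabs z0 / 2 by rewrite ge_min lexx orbT.
have bM := div_coef_bound _ _ _ _ z00 t0 tc aMt.
exists (Num.min d t); first by rewrite lt_min d0.
move=> z; rewrite lt_min => /andP[/fa {}fa]; set w := z - z0 in fa *; move=> wt.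
have zE : z = z0 + w by rewrite /w addrC subrK.
have zn0 : z != 0.
  rewrite -cabs_gt0 zE -[w]opprK; apply: lt_le_trans (lerB_cabs _ _).
  by rewrite cabsN; lra.
pose q := cabs w / t.
have q0 : 0 <= q by rewrite divr_ge0 ?cabs_ge0 ?(ltW t0).
have q1 : q < 1 by rewrite ltr_pdivrMr// mul1r.
rewrite -(cvg_shiftS (fun n => cabs (psum (div_coef z0 a) w n - g z))).
pose B := 2 * M / cabs z0.
apply: (@squeeze_cvgr _ _ _ _ (fun=> 0) (fun n => (cabs z)^-1 * (cabs (psum a w n.+1 - f z) + B * cabs w * q ^+ n))).
- near=> n; rewrite cabs_ge0 /= mulrC ler_pdivlMr ?cabs_gt0// mulrC -cabsM mulrBr -fg//.
  rewrite {1}zE psum_div_coef// addrAC; apply: le_trans (ler_cabsD _ _) _.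
  rewrite lerD2l cabsM cabsX exprSr mulrA [leRHS]mulrAC ler_wpM2r ?cabs_ge0//.
  rewrite /q expr_div_n mulrA ler_pdivlMr ?exprn_gt0// [leLHS]mulrAC ler_wpM2r ?exprn_ge0 ?cabs_ge0//; exact: bM.
- exact: cvg_cst.
- apply: cvg0Ml; rewrite -[X in _ --> X]addr0; apply: cvgD.
    by rewrite (cvg_shiftS (fun n => cabs (psum a w n - f z))).
  by apply: cvg0Ml; apply: cvg_expr; rewrite ger0_norm.
Unshelve. all: by end_near. Qed.

Lemma analytic_divX N a f : analytic_on D f -> taylor_at a f 0 ->
  (forall k, (k < N)%N -> a k = 0) ->
  exists g, [/\ analytic_on D g, taylor_at (fun k => a (N + k)%N) g 0 &
    forall z, D z -> f z = z ^+ N * g z].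
Proof.
move=> fD; elim: N a f fD => [|N IHN] a f fD fa aN.
  by exists f; split=> // z _; rewrite expr0 mul1r.
have a0 : a 0 = 0 by exact: aN.
pose g z := if z == 0 then a 1 else f z / z.
have gE z : z != 0 -> f z = z * g z.
  by move=> z0; rewrite /g (negbTE z0) mulrC divfK.
have g0 : g 0 = a 1 by rewrite /g eqxx.
have ga : taylor_at (fun k => a k.+1) g 0 by exact: (@taylor_at_div0 a f).
have gD : analytic_on D g.
  apply/analytic_onP => z0 z0D; have [->|z00] := eqVneq z0 0.
    by exists (fun k => a k.+1).
  move/analytic_onP: fD => /(_ _ z0D)[b fb].
  by exists (div_coef z0 b); exact: (@taylor_at_div b f).
have [k kN|h [hD ha hE]] := IHN _ _ gD ga; first exact: aN.
exists h; split=> // z zD; have [z0|z0] := eqVneq z 0.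
  by rewrite z0 (taylor_at0 _ _ _ fa) a0 exprS !mul0r.
by rewrite gE// hE// exprS mulrA.
Qed.

End global_taylor.

(** * The maximum modulus principle *)
Section maximum_modulus.
Context {R : realType}.
Local Notation C := R[i].
Local Notation D := (@unit_disk R).
Implicit Types (a b : nat -> C) (f g : C -> C) (z w : C) (r d : R).

(** [c] is the direction of [a0], arbitrary when [a0 = 0]. *)
Lemma cabs_aligned (a0 : C) : exists2 c : C, cabs c = 1 &
  forall t, 0 <= t -> cabs (a0 + t%:C * c) = cabs a0 + t.
Proof.
have [->|a00] := eqVneq a0 0.
  by exists 1 => [|t t0]; rewrite ?cabs1// add0r cabs0 add0r mulr1 cabsR ger0_norm.
have n0 : 0 < cabs a0 by rewrite cabs_gt0.
exists ((cabs a0)^-1%:C * a0) => [|t t0].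
  by rewrite cabsM cabsR gtr0_norm ?invr_gt0// mulVf// gt_eqF.
rewrite mulrA -rmorphM -{1}[a0]mul1r -mulrDl -(rmorph1 (real_complex R)) -rmorphD.
rewrite cabsM cabsR ger0_norm ?addr_ge0 ?divr_ge0 ?(ltW n0)// mulrDl mul1r.
by rewrite divfK// gt_eqF.
Qed.

(** Where it is not locally constant, [f] behaves like [a 0 + a m * w ^ m], and
    some direction [w] adds to [a 0] a positive multiple of it. *)
Lemma taylor_at_growth a f z0 : taylor_at a f z0 ->
  (exists2 d, 0 < d & forall z, cabs (z - z0) < d -> f z = f z0) \/
  (forall d, 0 < d -> exists2 z, cabs (z - z0) < d & cabs (f z0) < cabs (f z)).
Proof.
move=> fa; have f0 := taylor_at0 _ _ _ fa.
have [[k /andP[k0 ak]]|none] := pselect (exists k, (0 < k)%N && (a k != 0)); last first.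
  left; case: fa => d d0 fa; exists d => // z /fa {}fa.
  apply/eqP; rewrite f0 eq_sym -subr_eq0 -cabs_eq0; apply/eqP.
  apply: (@cvg_unique _ (@Rhausdorff R)) fa => //.
  apply: cvg_near_cst; near=> n.
  have n0 : (0 < n)%N by near: n; exact: nbhs_infty_gt.
  rewrite -(prednK n0) /psum big_ord_recl expr0 mulr1 big1 ?addr0// => i _.
  suff -> : a (lift ord0 i) = 0 by rewrite mul0r.
  by apply/eqP/negPn/negP => ai; apply: none; exists (lift ord0 i).
right=> d d0.
have ex : exists k, (0 < k)%N && (a k != 0) by exists k; rewrite k0.
case: (ex_minnP ex) => m /andP[m0 am] mmin {k k0 ak ex}.
have [K [e [K0 e0 rem]]] := taylor_remainder _ _ _ m.+1 fa.
have [c c1 align] := cabs_aligned (a 0).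
pose u : C := m.-root (c / a m).
have um : u ^+ m = c / a m by exact: rootCK.
pose t := Num.min (Num.min d e / (cabs u + 1)) (1 / (K * cabs u ^+ m.+1 + 1)).
have u1 : 0 < cabs u + 1 by rewrite ltr_wpDl ?cabs_ge0.
have K1 : 0 < K * cabs u ^+ m.+1 + 1.
  by rewrite ltr_wpDl// mulr_ge0// exprn_ge0// cabs_ge0.
have t0 : 0 < t by rewrite lt_min !divr_gt0// lt_min d0.
have tu : t * cabs u < Num.min d e.
  apply: lt_le_trans (_ : t * (cabs u + 1) <= _); first by rewrite ltr_pM2l// ltrDl.
  by rewrite -ler_pdivlMr// ge_min lexx.
have tK : K * cabs u ^+ m.+1 * t < 1.
  apply: lt_le_trans (_ : t * (K * cabs u ^+ m.+1 + 1) <= _).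
    by rewrite mulrC ltr_pM2l// ltrDl.
  by rewrite -ler_pdivlMr// ge_min lexx orbT.
pose z := z0 + t%:C * u; have zz0 : z - z0 = t%:C * u by rewrite /z addrC addKr.
have zt : cabs (z - z0) = t * cabs u by rewrite zz0 cabsM cabsR gtr0_norm.
exists z; first by rewrite zt (lt_le_trans tu)// ge_min lexx.
have := rem z; rewrite zt => /(_ (lt_le_trans tu _)).
rewrite ge_min lexx orbT => /(_ isT); rewrite zz0.
have -> : psum a (t%:C * u) m.+1 = a 0 + (t ^+ m)%:C * c.
  rewrite /psum big_ord_recr /= exprMn um mulrCA (mulrCA (a m)) divff// mulr1.
  rewrite -rmorphXn; congr (_ + _).
  rewrite -(prednK m0) big_ord_recl expr0 mulr1 big1 ?addr0// => i _.
  suff -> : a (lift ord0 i) = 0 by rewrite mul0r.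
  apply/eqP/negPn/negP => ai; have := mmin (lift ord0 i); rewrite ai andbT /= => /(_ isT).
  by rewrite /bump /= add1n leqNgt -{2}(prednK m0) ltnS ltn_ord.
have tm0 : 0 < t ^+ m by rewrite exprn_gt0.
have ac := align _ (ltW tm0).
set X := a 0 + _ in ac *; move=> fz; rewrite f0.
have := lerB_cabs X (X - f z).
have -> : X - (X - f z) = f z by rewrite opprB addrC subrK.
rewrite ac cabsB.
have : K * (t * cabs u) ^+ m.+1 < t ^+ m.
  have -> : K * (t * cabs u) ^+ m.+1 = t ^+ m * (K * cabs u ^+ m.+1 * t).
    by rewrite exprMn [t ^+ m.+1]exprSr; ring.
  by rewrite gtr_pMr.
lra.
Unshelve. all: by end_near. Qed.

Lemma cabs_rect_le (x y : R) : cabs (x +i* y) <= `|x| + `|y|.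
Proof.
rewrite -(@ler_pXn2r _ 2) ?nnegrE ?cabs_ge0 ?addr_ge0//.
rewrite sqr_cabs /= sqrrD !real_normK ?num_real// lerD2r lerDl.
by rewrite mulrn_wge0// mulr_ge0.
Qed.

Lemma plane_continuous (h : C -> R) (p : R * R) :
  (forall e, 0 < e -> exists2 d, 0 < d & forall z,
     cabs (z - (p.1 +i* p.2)) < d -> `|h z - h (p.1 +i* p.2)| < e) ->
  {for p, continuous (fun q : R * R => h (q.1 +i* q.2))}.
Proof.
move=> H; apply/cvgrPdist_lt => e /H[d d0 dP].
have d2 : 0 < d / 2 by rewrite divr_gt0.
apply: filterS (nbhsx_ballx p _ d2) => q [q1 q2]; rewrite distrC; apply: dP.
have -> : q.1 +i* q.2 - (p.1 +i* p.2) = (q.1 - p.1) +i* (q.2 - p.2) by [].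
apply: le_lt_trans (cabs_rect_le _ _) _.
rewrite [ltRHS](_ : _ = d / 2 + d / 2); last by field.
by rewrite distrC (distrC q.2) ltrD.
Qed.

Lemma continuous_cabs_plane : continuous (fun q : R * R => cabs (q.1 +i* q.2)).
Proof.
move=> p; apply: (@plane_continuous (@cabs R)) => e e0; exists e => // z.
by apply: le_lt_trans; exact: ler_dist_cabs.
Qed.

Lemma compact_disk r : compact [set p : R * R | cabs (p.1 +i* p.2) <= r].
Proof.
have sq : compact (`[-r, r]%classic `*` `[-r, r]%classic : set (R * R)).
  by apply: compact_setX; exact: segment_compact.
apply: (subclosed_compact _ sq).
  have /continuous_closedP := continuous_cabs_plane.
  by move=> /(_ [set x | x <= r]); apply; exact: closed_le.
move=> [x y] /=; have := sqr_cabs (x +i* y); have := cabs_ge0 (x +i* y).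
by move=> /= k0 e kr; split=> /=; rewrite in_itv /=; apply/andP; split; nra.
Qed.

Lemma analytic_continuous_cabs f (p : R * R) : analytic_on D f ->
  D (p.1 +i* p.2) ->
  {for p, continuous (fun q : R * R => cabs (f (q.1 +i* q.2)))}.
Proof.
move=> /analytic_onP fD pD; apply: (@plane_continuous (cabs \o f)) => e e0 /=.
have [a fa] := fD _ pD; set z0 := p.1 +i* p.2 in fa *.
have [K [d [K0 d0 rem]]] := taylor_remainder _ _ _ 1 fa.
exists (Num.min d (e / (K + 1))); first by rewrite lt_min d0 divr_gt0// ltr_wpDl.
move=> z; rewrite lt_min ltr_pdivlMr ?ltr_wpDl// => /andP[/rem].
rewrite /psum big_ord1 /= !expr0 mulr1 expr1 -(taylor_at0 _ _ _ fa) => h1 h2.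
apply: le_lt_trans (ler_dist_cabs _ _) _.
have := cabs_ge0 (z - z0); nra.
Qed.

(** Among the points of a closed disk where [|f|] is maximal, one of largest
    modulus lies on the boundary: at an interior one, [f] would be locally
    constant, and a neighbour farther from the centre would do better. *)
Lemma maximum_modulus f r M : analytic_on D f -> 0 < r -> r < 1 ->
  (forall z, cabs z = r -> cabs (f z) <= M) ->
  forall z, cabs z <= r -> cabs (f z) <= M.
Proof.
move=> fD r0 r1 fM.
pose K := [set p : R * R | cabs (p.1 +i* p.2) <= r].
pose G (p : R * R) := cabs (f (p.1 +i* p.2)).
have KD p : K p -> D (p.1 +i* p.2) by move=> Kp; exact: le_lt_trans Kp r1.
have Gc p : K p -> {for p, continuous G}.
  by move=> /KD; exact: analytic_continuous_cabs.
have K0 : K !=set0 by exists (0, 0); rewrite /K /= cabs0 ltW.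
have cK : compact K := compact_disk r.
have [q Kq Gq] := compact_EVT_max K0 cK (continuous_in_subspaceT (fun p Kp => Gc p (set_mem Kp))).
pose B := ~` (interior [set p | G p < G q]).
have cB : closed B by apply: open_closedC; exact: open_interior.
have cKB : compact (K `&` B) by exact: compact_closedI.
have KBq : (K `&` B) q.
  by split; [exact: set_mem|move=> /nbhs_singleton /=; rewrite ltxx].
have KBE p : (K `&` B) p -> G p = G q.
  move=> [Kp Bp]; apply/eqP; rewrite eq_le Gq ?inE//= leNgt; apply/negP => lt.
  by apply: Bp; exact: (cvgr_lt (G p) (Gc p Kp)).
have [p Kp pmax] := compact_EVT_max (ex_intro _ q KBq) cKB
  (continuous_subspaceT (@continuous_cabs_plane)).
have {}Kp := set_mem Kp; have [Kp' Bp] := Kp; have GpE := KBE _ Kp.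
set z0 := p.1 +i* p.2.
have z0r : cabs z0 <= r by [].
move=> z zr; apply: (@le_trans _ _ (cabs (f z0))).
  have := Gq (complex.Re z, complex.Im z); rewrite /G/= -/z0.
  have -> : cabs (f z0) = G q by [].
  by case: z zr => x y zr; apply; rewrite inE.
move: z0r; rewrite le_eqVlt => /orP[/eqP /fM//|z0lt]; exfalso.
have /analytic_onP/(_ _ (KD _ Kp'))[a fa] := fD.
have inK w : cabs (w - z0) < r - cabs z0 -> K (complex.Re w, complex.Im w).
  move=> wz; rewrite /K /=; case: w wz => x y /= wz.
  rewrite -(subrK z0 (x +i* y)); apply: le_trans (ler_cabsD _ _) _; lra.
have d0 : 0 < r - cabs z0 by rewrite subr_gt0.
case: (taylor_at_growth _ _ _ fa) => [[d dpos dP]|/(_ _ d0)[w wz]]; last first.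
  have := Gq _ (mem_set (inK w wz)); rewrite -GpE /G /= -/z0.
  by case: w {wz} => x y /=; rewrite leNgt => /negP.
have [c c1 align] := cabs_aligned z0.
pose t := Num.min d (r - cabs z0) / 2.
have m0 : 0 < Num.min d (r - cabs z0) by rewrite lt_min dpos.
have t0 : 0 < t by rewrite divr_gt0.
have tlt : t < Num.min d (r - cabs z0) by rewrite /t; lra.
pose w := z0 + t%:C * c.
have wz0 : cabs (w - z0) = t by rewrite /w addrC addKr cabsM c1 mulr1 cabsR gtr0_norm.
have wd : cabs (w - z0) < d by rewrite wz0 (lt_le_trans tlt)// ge_min lexx.
have wr : cabs (w - z0) < r - cabs z0 by rewrite wz0 (lt_le_trans tlt)// ge_min lexx orbT.
have KBw : (K `&` B) (complex.Re w, complex.Im w).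
  split; first exact: inK.
  move=> /nbhs_singleton /=; rewrite -(KBE _ Kp) /G /= -/z0.
  by case: (w) (dP _ wd) => x y /= ->; rewrite ltxx.
have := pmax _ (mem_set KBw); rewrite /= -/z0.
have -> : complex.Re w +i* complex.Im w = w by case: (w).
by rewrite /w align ?(ltW t0)//; lra.
Qed.

End maximum_modulus.

(** * Taylor expansion on the whole disk *)
Section global_expansion.
Context {R : realType}.
Local Notation C := R[i].
Local Notation D := (@unit_disk R).
Implicit Types (a b : nat -> C) (f g : C -> C) (z w : C) (r d : R).

(** The maximum modulus principle for [f / z ^ N]. *)
Lemma schwarz_lemma N a f r M : analytic_on D f -> taylor_at a f 0 ->
  (forall k, (k < N)%N -> a k = 0) -> 0 < r -> r < 1 ->
  (forall z, cabs z = r -> cabs (f z) <= M) ->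
  (forall z, cabs z <= r -> cabs (f z) <= M * (cabs z / r) ^+ N) /\
  cabs (a N) * r ^+ N <= M.
Proof.
move=> fD fa aN r0 r1 fM.
have [g [gD ga fE]] := analytic_divX _ _ _ fD fa aN.
have rN : 0 < r ^+ N by rewrite exprn_gt0.
have gM z : cabs z <= r -> cabs (g z) <= M / r ^+ N.
  apply: (@maximum_modulus _ g r) => // w wr.
  rewrite ler_pdivlMr// mulrC -{1}wr -cabsX -cabsM -fE ?fM//.
  by rewrite /unit_disk /= wr.
split=> [z zr|].
  rewrite fE; last exact: le_lt_trans zr r1.
  by rewrite cabsM cabsX expr_div_n [leRHS]mulrCA ler_wpM2l ?exprn_ge0 ?cabs_ge0 ?gM.
have := gM 0; rewrite cabs0 (taylor_at0 _ _ _ ga) addn0 => /(_ (ltW r0)).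
by rewrite ler_pdivlMr.
Qed.

(** Averaging [f] with a rotated copy of itself kills the coefficient of index
    [i], keeps the one of index [k], and does not increase the maximum of [|f|]
    on a circle.  Once all coefficients before [k] are gone, the Schwarz lemma
    bounds the one of index [k]. *)
Lemma cauchy_estimate a f r M : analytic_on D f -> taylor_at a f 0 ->
  0 < r -> r < 1 -> (forall z, cabs z = r -> cabs (f z) <= M) ->
  forall k, cabs (a k) * r ^+ k <= M.
Proof.
move=> fD fa r0 r1 fM k.
suff H i : (i <= k)%N -> exists g b, [/\ analytic_on D g, taylor_at b g 0,
    (forall z, cabs z = r -> cabs (g z) <= M),
    (forall j, (j < i)%N -> b j = 0) & b k = a k].
  have [g [b [gD gb gM bk <-]]] := H k (leqnn k).
  by have [] := @schwarz_lemma k b g r M gD gb bk r0 r1 gM.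
elim: i => [_|i IHi ik]; first by exists f, a; split.
have [g [b [gD gb gM bi bk]]] := IHi (ltnW ik).
have ki : (0 < k - i)%N by rewrite subn_gt0.
have [u uN u1] := @rootN1_exists R (k - i) ki.
have u0 : u != 0 by rewrite -cabs_gt0 u1.
have uk : u ^- k * u ^+ i = -1.
  rewrite -(subnK (ltnW ik)) exprD uN mulN1r invrN mulNr mulVf//.
  by rewrite expf_neq0.
have tay b' z0 : taylor_at b' g z0 -> forall b2, taylor_at b2 g (u * z0) ->
    taylor_at (fun j => 2^-1 * (b' j + u ^- k * (u ^+ j * b2 j)))
      (fun z => 2^-1 * (g z + u ^- k * g (u * z))) z0.
  move=> h1 b2 h2; apply: taylor_atZ; apply: taylor_atD => //.
  by apply: taylor_atZ; exact: taylor_at_rotation.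
exists (fun z => 2^-1 * (g z + u ^- k * g (u * z))).
exists (fun j => 2^-1 * (b j + u ^- k * (u ^+ j * b j))); split.
- apply/analytic_onP => z0 z0D; move/analytic_onP : gD => gD.
  have [b1 h1] := gD _ z0D.
  have [|b2 h2] := gD (u * z0); first by rewrite /unit_disk /= cabsM u1 mul1r.
  by eexists; exact: (tay _ _ h1 _ h2).
- by apply: tay => //; rewrite mulr0.
- move=> z zr; rewrite cabsM cabsV cabs_nat mulrC ler_pdivrMr//.
  apply: le_trans (ler_cabsD _ _) _; rewrite mulr_natr mulr2n lerD ?gM//.
  by rewrite cabsM cabsV cabsX u1 expr1n invr1 mul1r gM// cabsM u1 mul1r.
- move=> j; rewrite ltnS leq_eqVlt => /orP[/eqP ->|/bi ->].
    by rewrite mulrA uk mulN1r subrr mulr0.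
  by rewrite !mulr0 addr0 mulr0.
- rewrite mulrA mulVf ?expf_neq0// mul1r bk -mulr2n -[a k *+ 2]mulr_natl mulrA.
  by rewrite mulVf ?mul1r// pnatr_eq0.
Qed.

Lemma expr_linear_le (s : R) n : 0 <= s -> s < 1 ->
  n.+1%:R * s ^+ n <= (1 - s)^-1.
Proof.
move=> s0 s1; have d0 : 0 < 1 - s by rewrite subr_gt0.
rewrite -[(1 - s)^-1]div1r ler_pdivlMr//.
apply: le_trans (_ : (\sum_(i < n.+1) s ^+ i) * (1 - s) <= _).
  rewrite ler_wpM2r ?(ltW d0)// -[n.+1 in leLHS]card_ord -sumr_const mulr_suml.
  by apply: ler_sum => i _; rewrite mul1r ler_wiXn2l ?(ltW s1)// -ltnS.
rewrite mulrC -opprB mulNr -subrX1 opprB gerBl exprn_ge0//.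
Qed.

Lemma analytic_bounded f r : analytic_on D f -> 0 < r -> r < 1 ->
  exists M, forall z, cabs z <= r -> cabs (f z) <= M.
Proof.
move=> fD r0 r1; pose K := [set p : R * R | cabs (p.1 +i* p.2) <= r].
have K0 : K !=set0 by exists (0, 0); rewrite /K /= cabs0 ltW.
have Gc p : p \in K -> {for p, continuous (fun q : R * R => cabs (f (q.1 +i* q.2)))}.
  by rewrite inE => Kp; apply: analytic_continuous_cabs => //; exact: le_lt_trans Kp r1.
have [q Kq Gq] := compact_EVT_max K0 (compact_disk r) (continuous_in_subspaceT Gc).
exists (cabs (f (q.1 +i* q.2))) => z zr.
by have := Gq (complex.Re z, complex.Im z); case: z zr => x y zr /=; apply; rewrite inE.
Qed.

(** Let [rho < r < 1] and [|f| <= M] on [|z| = r].  The remainder after [n] terms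
    vanishes to order [n] at [0] and, by the Cauchy estimates, is at most
    [(n + 1) * M] on that circle; so it is at most
    [(n + 1) * M * (rho / r) ^ n] on [|z| <= rho]. *)
Lemma taylor_uniform f : analytic_on D f -> exists a, forall rho e : R,
  0 < rho -> rho < 1 -> 0 < e ->
  \forall n \near \oo, forall z, cabs z <= rho -> cabs (psum a z n - f z) <= e.
Proof.
move=> fD; have [|a fa] := (analytic_onP D f).1 fD 0.
  by rewrite /unit_disk /= cabs0.
exists a => rho e rho0 rho1 e0; pose r := (1 + rho) / 2.
have [r0 r1 rr] : [/\ 0 < r, r < 1 & rho < r] by rewrite /r; split; lra.
have [M fM] := analytic_bounded _ _ fD r0 r1.
have fMc z : cabs z = r -> cabs (f z) <= M by move=> zr; rewrite fM ?zr.
have M0 : 0 <= M by apply: le_trans (fM 0 _); rewrite ?cabs_ge0// cabs0 ltW.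
have aM := cauchy_estimate _ _ _ _ fD fa r0 r1 fMc.
pose q := rho / r.
have q0 : 0 < q by rewrite divr_gt0.
have q1 : q < 1 by rewrite ltr_pdivrMr// mul1r.
(* half of the geometric decay absorbs the factor [n + 1] *)
pose s := Num.sqrt q.
have sq : s ^+ 2 = q by rewrite sqr_sqrtr// ltW.
have s0 : 0 <= s by exact: sqrtr_ge0.
have s1 : s < 1 by rewrite -sqrtr1 ltr_sqrt.
have rest n z : cabs z <= rho -> cabs (psum a z n - f z) <= M / (1 - s) * s ^+ n.
  move=> zrho; rewrite cabsB.
  pose p := taylor_poly a n; pose b k := a k - p`_k.
  pose h z := f z + (-1) * p.[z].
  have hb : taylor_at b h 0.
    have := taylor_atD _ _ _ _ _ fa (taylor_atZ (-1) _ _ _ (taylor_at_horner p 0)).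
    rewrite addr0 comp_polyXr (_ : (fun k => _) = b)//.
    by apply/funext => k; rewrite mulN1r.
  have hD : analytic_on D h.
    apply/analytic_onP => z0 z0D; have [a0 fa0] := (analytic_onP D f).1 fD _ z0D.
    eexists; apply: (taylor_atD _ _ _ _ _ fa0); apply: taylor_atZ.
    exact: taylor_at_horner.
  have b0 k : (k < n)%N -> b k = 0 by move=> kn; rewrite /b coef_poly kn subrr.
  have hM w : cabs w = r -> cabs (h w) <= n.+1%:R * M.
    move=> wr; rewrite /h mulN1r; apply: le_trans (ler_cabsB _ _) _.
    rewrite -natr1 mulrDl mul1r addrC lerD ?fMc//.
    rewrite -psum_horner; apply: le_trans (ler_cabs_sum _ _ _ _) _.
    rewrite -[n in leRHS]card_ord -sumr_const mulr_suml; apply: ler_sum => k _.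
    by rewrite mul1r cabsM cabsX wr.
  have [H _] := schwarz_lemma n b h r _ hD hb b0 r0 r1 hM.
  rewrite psum_horner -mulN1r -/p -/(h z).
  apply: le_trans (H z (le_trans zrho (ltW rr))) _.
  apply: le_trans (_ : n.+1%:R * M * q ^+ n <= _).
    have zr0 : 0 <= cabs z / r by apply: divr_ge0 (cabs_ge0 z) (ltW r0).
    rewrite ler_wpM2l ?mulr_ge0// lerXn2r ?nnegrE ?(ltW q0)//.
    by rewrite /q ler_pM2r ?invr_gt0.
  rewrite -sq -exprM mul2n -addnn exprD.
  rewrite (_ : _ * _ = M * (n.+1%:R * s ^+ n) * s ^+ n); last by ring.
  by rewrite ler_wpM2r ?exprn_ge0// ler_wpM2l// expr_linear_le.
have cv : M / (1 - s) * s ^+ n @[n --> \oo] --> (0 : R).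
  by apply: cvg0Ml; apply: cvg_expr; rewrite ger0_norm.
near=> n => z zrho; apply: le_trans (rest n z zrho) _.
by apply: ltW; near: n; exact: (cvgr_lt 0 cv).
Unshelve. all: by end_near. Qed.

End global_expansion.

(** * Taylor coefficients and the Bergman norm *)
Section bergman_expansion.
Context {R : realType}.
Local Notation C := R[i].
Local Notation D := (@unit_disk R).
Local Notation W := (@normalized_area R).
Local Notation V := (@disk_area R).
Local Notation plane := (measurableTypeR R * measurableTypeR R)%type.
Implicit Types (a b : nat -> C) (f g : C -> C) (z w : C) (r d : R).

Lemma coef_norm2_taylor a n :
  coef_norm2 (taylor_poly a n) = \sum_(k < n) cabs (a k) ^+ 2 / k.+1%:R.
Proof.
rewrite (@coef_norm2E _ n) ?size_poly//; apply: eq_bigr => k _.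
by rewrite coef_poly ltn_ord.
Qed.

Lemma coef_norm2_taylorB a m n : (n <= m)%N ->
  coef_norm2 (taylor_poly a m - taylor_poly a n) =
  coef_norm2 (taylor_poly a m) - coef_norm2 (taylor_poly a n).
Proof.
move=> nm; rewrite (@coef_norm2E _ m); last first.
  apply: leq_trans (size_polyD _ _) _; rewrite size_polyN geq_max size_poly.
  exact: leq_trans (size_poly _ _) nm.
rewrite (@coef_norm2E _ m (taylor_poly a m)) ?size_poly//.
rewrite (@coef_norm2E _ m (taylor_poly a n)); last exact: leq_trans (size_poly _ _) nm.
rewrite -sumrB; apply: eq_bigr => k _; rewrite coefB !coef_poly ltn_ord.
by case: ifP => _; rewrite ?subrr ?subr0 cabs0 expr0n/= mul0r ?subrr ?subr0.
Qed.

Lemma disk_integral_horner_dilation a n r : 0 < r ->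
  disk_integral r (fun z => cabs (taylor_poly a n).[z] ^+ 2) =
  (V * \sum_(k < n) cabs (a k) ^+ 2 / k.+1%:R * (r ^+ 2) ^+ k.+1)%:E.
Proof.
move=> r0; rewrite disk_integral_dilation//; last 2 first.
- exact: plane_measurable_horner_cabs2.
- by move=> z; exact: sqr_ge0.
pose b k := a k * (r%:C) ^+ k.
rewrite (@eq_disk_integral _ _ _ (fun z => cabs (taylor_poly b n).[z] ^+ 2)); last first.
  move=> z; rewrite /taylor_poly !horner_poly; congr (cabs _ ^+ 2).
  by apply: eq_bigr => k _; rewrite exprMn mulrA.
rewrite disk_integral_horner -EFinM coef_norm2_taylor mulrCA; congr (_ * _)%:E.
rewrite mulr_sumr; apply: eq_bigr => k _.
rewrite /b cabsM cabsX cabsR gtr0_norm// exprMn [(r ^+ k) ^+ 2]exprAC [(r ^+ 2) ^+ k.+1]exprS.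
by set y := (r ^+ 2) ^+ k; ring.
Qed.

(** [N] is the squared norm.  On smaller disks the Taylor polynomials converge
    uniformly, so that [|f| ^ 2] taken twice, plus a small constant, dominates
    their squares; letting the radius tend to [1] bounds their norms by [2 * N].
    Conversely, Fatou's lemma bounds [N] by any bound on their norms. *)
Lemma bergman_expansion f : bergman_space f ->
  exists a (N : R), [/\ (bergman_norm f ^+ 2 = N%:E)%E,
    forall z, D z -> cabs (psum a z n - f z) @[n --> \oo] --> (0 : R),
    forall n, W * coef_norm2 (taylor_poly a n) <= 2 * N &
    forall S, (forall n, W * coef_norm2 (taylor_poly a n) <= S) -> N <= S].
Proof.
move=> [fD fn]; have [a fa] := taylor_uniform _ fD.
have pt z : D z -> cabs (psum a z n - f z) @[n --> \oo] --> (0 : R).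
  move=> zD; apply/cvgrPdist_le => e e0.
  pose rho := (1 + cabs z) / 2.
  have z0 := cabs_ge0 z; have z1 : cabs z < 1 by [].
  have [r0 r1 zr] : [/\ 0 < rho, rho < 1 & cabs z <= rho] by rewrite /rho; split; lra.
  have := fa _ _ r0 r1 e0; apply: filterS => n /(_ z zr).
  by rewrite sub0r normrN ger0_norm ?cabs_ge0.
have pi0 : 0 < pi :> R by exact: pi_gt0.
pose F z : R := if cabs z < 1 then cabs (f z) ^+ 2 else 0.
pose P n z : R := if cabs z < 1 then cabs (taylor_poly a n).[z] ^+ 2 else 0.
have F0 z : 0 <= F z by rewrite /F; case: ifP => // _; exact: sqr_ge0.
have P0 n z : 0 <= P n z by rewrite /P; case: ifP => // _; exact: sqr_ge0.
have mP n : plane_measurable (P n).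
  by apply: plane_measurable_if; exact: plane_measurable_horner_cabs2.
have PF z : P n z @[n --> \oo] --> F z.
  rewrite /P /F; case: ifP => zD; last exact: cvg_cst.
  by apply/cvg_sqr/cvg_cabs; under eq_fun do rewrite -psum_horner; exact: pt.
have mF : plane_measurable F.
  apply: (@measurable_fun_cvg _ _ _ _ (fun n p => P n (p.1 +i* p.2))).
    exact: mP.
  by move=> p _; exact: PF.
have IE : disk_integral 1 (fun z => cabs (f z) ^+ 2) = disk_integral 1 F.
  by rewrite (@disk_integral_sub _ 1)// lexx.
pose I := fine (disk_integral 1 F).
have IF : disk_integral 1 F = I%:E.
  rewrite /I fineK// ge0_fin_numE ?disk_integral_ge0// -IE.
  have : (bergman_norm f ^+ 2 < +oo)%E.
    have := fn; have : (0 <= bergman_norm f)%E by exact: sqrte_ge0.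
    by case: (bergman_norm f) => // x _ _; rewrite ltry.
  rewrite sqr_bergman_norm; have := disk_integral_ge0 1 (fun z => cabs (f z) ^+ 2).
  move=> /(_ (fun z => sqr_ge0 _)).
  by case: disk_integral => // [x|] _; rewrite ?ltry// gt0_muley// lte_fin invr_gt0.
have I0 : 0 <= I by rewrite /I fine_ge0// disk_integral_ge0.
exists a, (I / pi); split=> //.
- by rewrite sqr_bergman_norm IE IF -EFinM mulrC.
- move=> m; rewrite /normalized_area mulrAC mulrA ler_pM2r ?invr_gt0//.
  rewrite coef_norm2_taylor.
  pose Q : {poly R} := \sum_(k < m) (cabs (a k) ^+ 2 / k.+1%:R) *: 'X^(k.+1).
  have QE x : Q.[x] = \sum_(k < m) cabs (a k) ^+ 2 / k.+1%:R * x ^+ k.+1.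
    by rewrite horner_sum; apply: eq_bigr => k _; rewrite hornerZ hornerXn.
  suff H x : 0 < x -> x < 1 -> V * Q.[x] <= 2 * I.
    have := @horner_ge0_at1 _ ((2 * I)%:P - V *: Q).
    rewrite hornerD hornerN hornerZ hornerC subr_ge0 QE.
    under eq_bigr do rewrite expr1n mulr1.
    apply=> x x0 x1; rewrite hornerD hornerN hornerZ hornerC subr_ge0.
    exact: H.
  move=> x0 x1; pose r := Num.sqrt x.
  have rx : r ^+ 2 = x by rewrite sqr_sqrtr// ltW.
  have r0 : 0 < r by rewrite sqrtr_gt0.
  have r1 : r < 1 by rewrite -sqrtr1 ltr_sqrt.
  apply/ler_addgt0Pr => e e0.
  have V0 : 0 <= V := disk_area_ge0.
  pose e' := Num.sqrt (e / (2 * (V + 1))).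
  have V1 : 0 < 2 * (V + 1) by lra.
  have e'0 : 0 < e' by rewrite sqrtr_gt0 divr_gt0.
  have e'2 : 2 * e' ^+ 2 * V <= e.
    rewrite sqr_sqrtr; last by rewrite divr_ge0// ltW.
    have -> : 2 * (e / (2 * (V + 1))) * V = e * (V / (V + 1)).
      by field; rewrite gt_eqF//; lra.
    by rewrite ler_piMr ?(ltW e0)// ler_pdivrMr ?mul1r ?lerDl//; lra.
  have [c c0 cE] : exists2 c, 0 <= c & c = 2 * e' ^+ 2.
    by exists (2 * e' ^+ 2) => //; apply: mulr_ge0 => //; exact: sqr_ge0.
  rewrite -cE in e'2.
  have [n nm Hn] : exists2 n, (m <= n)%N & forall z, cabs z <= r -> cabs (psum a z n - f z) <= e'.
    have [N _ NP] := fa r e' r0 r1 e'0.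
    by exists (maxn m N); [exact: leq_maxl|apply: NP; exact: leq_maxr].
  rewrite -lee_fin; apply: (@le_trans _ _ (disk_integral r (fun z => cabs (taylor_poly a n).[z] ^+ 2))).
    rewrite disk_integral_horner_dilation// lee_fin rx ler_wpM2l// QE.
    rewrite (big_ord_widen _ (fun k => cabs (a k) ^+ 2 / k.+1%:R * x ^+ k.+1) nm).
    rewrite [leRHS](bigID (fun k : 'I_n => (k < m)%N)) /= lerDl.
    by apply: sumr_ge0 => k _; rewrite mulr_ge0 ?exprn_ge0 ?divr_ge0 ?sqr_ge0 ?(ltW x0).
  have mc := plane_measurable_cst (c).
  have m2F : plane_measurable (fun z => 2 * F z).
    by apply: measurable_funM => //; exact: measurable_cst.
  have mFe : plane_measurable (fun z => 2 * F z + c) by exact: measurable_funD.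
  have Fe0 z : 0 <= 2 * F z + c by rewrite addr_ge0// mulr_ge0.
  apply: (@le_trans _ _ (disk_integral 1 (fun z => 2 * F z + c))).
    apply: (@le_trans _ _ (disk_integral r (fun z => 2 * F z + c))).
      apply: le_disk_integral => //.
      - exact: plane_measurable_horner_cabs2.
      - by move=> z; exact: sqr_ge0.
      move=> z zr; have zr1 : cabs z < 1 by exact: lt_trans r1.
      rewrite /F cE zr1 -[_.[z]](subrK (f z)) addrC.
      apply: le_trans (sqr_cabsD_le2 _ _) _; rewrite lerD2l ler_wpM2l//.
      rewrite lerXn2r ?nnegrE ?cabs_ge0 ?(ltW e'0)//.
      by have := Hn z (ltW zr); rewrite psum_horner.
    rewrite (@disk_integral_sub _ r) ?(ltW r1)//; apply: le_disk_integral => //.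
      exact: plane_measurable_if.
      by move=> z; case: ifP.
    by move=> z _; case: ifP.
  rewrite disk_integralD// ?disk_integralZ//; last by move=> z; rewrite mulr_ge0.
  rewrite IF (@eq_disk_integral _ _ (fun=> c) (fun z => c * @cst C R 1 z)); last first.
    by move=> z; rewrite /= mulr1.
  rewrite disk_integralZ ?disk_areaE//; last exact: plane_measurable_cst.
  by rewrite -!EFinM -EFinD lee_fin lerD2l.
- move=> S HS; rewrite ler_pdivrMr// -lee_fin -IF.
  pose Pn n (p : plane) := (P n (p.1 +i* p.2))%:E.
  have mD := @measurable_disk R 1.
  have mPn n : measurable_fun [set p : plane | cabs (p.1 +i* p.2) < 1] (Pn n).
    by apply/measurable_EFinP; apply: measurable_funS (mP n).
  have Pn0 n p : [set p : plane | cabs (p.1 +i* p.2) < 1] p -> (0 <= Pn n p)%E.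
    by rewrite lee_fin.
  have := @fatou _ _ _ (@lebesgue_measure R \x @lebesgue_measure R)%E _ mD Pn mPn Pn0.
  have -> : (\int[(@lebesgue_measure R \x @lebesgue_measure R)%E]_(p in [set p | (cabs (p.1 +i* p.2) < 1)%R]) limn_einf (Pn^~ p) = disk_integral 1 F)%E.
    apply: eq_integral => p _.
    have : (Pn n p @[n --> \oo] --> (F (p.1 +i* p.2))%:E)%E.
      by apply/fine_cvgP; split; [exact: nearW|exact: PF].
    by move/cvg_limn_einf_sup => -[].
  move/le_trans; apply.
  rewrite limn_einf_lim; apply: lime_le; first exact: is_cvg_einfs.
  apply: nearW => n; apply: (@le_trans _ _ (disk_integral 1 (P n))).
    by apply: ereal_inf_lbound; exists n => /=.
  rewrite -(@disk_integral_sub _ 1) ?lexx// disk_integral_horner lee_fin.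
  by rewrite -ler_pdivrMr// mulrAC; exact: HS.
Qed.

End bergman_expansion.

(** * From polynomials to the Bergman space *)
Section density.
Context {R : realType}.
Local Notation C := R[i].
Local Notation D := (@unit_disk R).
Local Notation W := (@normalized_area R).
Implicit Types (f g : C -> C) (z l : C) (L : set C) (s : seq C).

Lemma sample_cvg (p : nat -> {poly C}) f l :
  cabs ((p n).[l] - f l) @[n --> \oo] --> (0 : R) ->
  sample (horner (p n)) l @[n --> \oo] --> sample f l.
Proof.
move=> /cvg_cabs/cvg_sqr pf; rewrite /sample; apply: cvgM pf _.
exact: cvg_cst.
Qed.

Lemma sum_sample_cvg s (p : nat -> {poly C}) f :
  (forall l, l \in s -> cabs ((p n).[l] - f l) @[n --> \oo] --> (0 : R)) ->
  \sum_(l <- s) sample (horner (p n)) l @[n --> \oo] --> \sum_(l <- s) sample f l.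
Proof.
elim: s => [|l s IHs] H.
  by under eq_fun do rewrite big_nil; rewrite big_nil; exact: cvg_cst.
under eq_fun do rewrite big_cons; rewrite big_cons; apply: cvgD.
  by apply: sample_cvg; apply: H; rewrite mem_head.
by apply: IHs => k ks; apply: H; rewrite in_cons ks orbT.
Qed.

Lemma sum_sample_le s (p : nat -> {poly C}) f K :
  (forall l, l \in s -> cabs ((p n).[l] - f l) @[n --> \oo] --> (0 : R)) ->
  (\forall n \near \oo, \sum_(l <- s) sample (horner (p n)) l <= K) ->
  \sum_(l <- s) sample f l <= K.
Proof.
move=> /sum_sample_cvg pf H; rewrite -(cvg_lim _ pf)//.
by apply: limr_le => //; apply/cvg_ex; eexists; exact: pf.
Qed.

(** Sampling inequalities for polynomials extend to the Bergman space along
    Taylor polynomials.  The tails of the Taylor series are orthogonal to its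
    heads, so that they are small once the increasing norms of the heads are
    close to their supremum. *)
Lemma sampling_set_of_bounds L A B : L `<=` D -> 0 < A -> 0 < B ->
  sampling_bounds L A B -> sampling_set L.
Proof.
move=> LD A0 B0 LB; split=> //; exists (A / 2), (2 * B); split; rewrite ?divr_gt0 ?mulr_gt0//.
move=> f fB; have [a [N [-> pt Nlo Nup]]] := bergman_expansion _ fB.
under eq_esum do rewrite sampleE; rewrite -!EFinM.
pose p n := taylor_poly a n; pose u n := W * coef_norm2 (p n).
have W0 : 0 <= W by exact: normalized_area_ge0.
have uN n : u n <= 2 * N by exact: Nlo.
have pf l : D l -> cabs ((p n).[l] - f l) @[n --> \oo] --> (0 : R).
  by move=> /pt; under eq_fun do rewrite psum_horner.
have up s : uniq s -> [set` s] `<=` L -> \sum_(l <- s) sample f l <= 2 * B * N.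
  move=> us sL; apply: (@sum_sample_le _ p).
    by move=> l ls; exact/pf/LD/sL.
  apply: nearW => n.
  have [_ /(esum_leP _ _ _ (sample_ge0 _))/(_ s us sL)] := LB (p n).
  by move/le_trans; apply; rewrite [leRHS]mulrAC [leRHS]mulrC ler_wpM2l ?(ltW B0) ?uN.
have SB : (\esum_(l in L) (sample f l)%:E <= (2 * B * N)%:E)%E.
  exact/(esum_leP _ _ _ (sample_ge0 _)).
split=> //.
have [t tE] : exists t, \esum_(l in L) (sample f l)%:E = t%:E.
  have : (0 <= \esum_(l in L) (sample f l)%:E)%E.
    by apply: esum_ge0 => l _; rewrite lee_fin sample_ge0.
  by case: (\esum_(l in L) _) SB => [t||] // _ _; exists t.
rewrite tE lee_fin.
have tS s : uniq s -> [set` s] `<=` L -> \sum_(l <- s) sample f l <= t.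
  have /(esum_leP _ _ _ (sample_ge0 f)) : (\esum_(l in L) (sample f l)%:E <= t%:E)%E.
    by rewrite tE.
  exact.
suff H e : 0 < e -> N <= (2 * t + 2 * B * e) / A + e.
  have A1 : 0 < 2 * B / A + 1 by rewrite ltr_pwDr// divr_ge0// ?mulr_ge0 ?ltW.
  rewrite mulrAC ler_pdivrMr// mulrC -ler_pdivlMr// (mulrC t).
  apply/ler_addgt0Pr => e e0; have := H (e / (2 * B / A + 1)).
  rewrite divr_gt0// => /(_ isT)/le_trans; apply.
  rewrite mulrDl -addrA lerD2l le_eqVlt; apply/orP; left; apply/eqP.
  by field; apply/andP; split; rewrite gt_eqF//; lra.
move=> e0.
have [n un] : exists n, forall m, u m <= u n + e.
  have hs : has_sup (range u).
    by split; [exists (u 0%N), 0%N|exists (2 * N) => _ [n _ <-]].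
  have [_ [n _ <-] un] := sup_adherent e0 hs; exists n => m.
  rewrite -lerBlDr; apply: le_trans (ltW un); rewrite lerD2r.
  by apply: sup_upper_bound => //; exists m.
apply: Nup => m; apply: le_trans (un m) _; rewrite lerD2r ler_pdivlMr// mulrC.
have [+ _] := LB (p n); rewrite -lee_fin => /le_trans; apply.
apply/(esum_leP _ _ _ (sample_ge0 _)) => s us sL.
have rest : \sum_(l <- s) sample (fun z => (p n).[z] - f z) l <= B * e.
  rewrite (eq_bigr (sample (fun z => f z - (p n).[z]))); last first.
    by move=> l _; rewrite /sample cabsB.
  apply: (@sum_sample_le _ (fun m => p m - p n)).
    move=> l ls; have := pf _ (LD _ (sL _ ls)).
    apply: cvg_trans; apply: near_eq_cvg; apply: nearW => k.
    by rewrite hornerD hornerN opprB addrA subrK.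
  near=> k; have nk : (n <= k)%N by near: k; exact: nbhs_infty_ge.
  have [_ /(esum_leP _ _ _ (sample_ge0 _))/(_ s us sL)] := LB (p k - p n).
  move/le_trans; apply; rewrite ler_wpM2l ?(ltW B0)//.
  by rewrite coef_norm2_taylorB// mulrBr lerBlDl; exact: un.
apply: le_trans (_ : \sum_(l <- s) (2 * sample f l + 2 * sample (fun z => (p n).[z] - f z) l) <= _).
  apply: ler_sum => l _; rewrite /sample.
  rewrite [leRHS](_ : _ = (2 * cabs (f l) ^+ 2 + 2 * cabs ((p n).[l] - f l) ^+ 2) *
    (1 - cabs l ^+ 2) ^+ 2); last by ring.
  rewrite ler_wpM2r ?sqr_ge0//.
  by rewrite -{1}(subrK (f l) (p n).[l]) addrC sqr_cabsD_le2.
rewrite big_split -!mulr_sumr /= -mulrA lerD// ler_wpM2l//; exact: tS.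
Unshelve. all: by end_near. Qed.

End density.

(** * Weak limits of Marcinkiewicz-Zygmund families *)
Section finite_choices.
Context {R : realType} {T : eqType}.

Lemma common_radius (P : T -> R -> Prop) (s : seq T) :
  (forall l d d', 0 < d' -> d' <= d -> P l d -> P l d') ->
  (forall l, l \in s -> exists2 d, 0 < d & P l d) ->
  exists2 d, 0 < d & forall l, l \in s -> P l d.
Proof.
move=> Pd; elim: s => [|l s IHs] H; first by exists 1.
have [|d d0 dP] := IHs; first by move=> k ks; apply: H; rewrite in_cons ks orbT.
have [e e0 eP] := H l (mem_head _ _).
have m0 : 0 < Num.min d e by rewrite lt_min d0.
exists (Num.min d e) => // k; rewrite in_cons => /orP[/eqP ->|/dP].
  by apply: Pd eP => //; rewrite ge_min lexx orbT.
by apply: Pd => //; rewrite ge_min lexx.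
Qed.

Lemma ler_sum_subset (s t : seq T) (F : T -> R) : uniq s -> uniq t ->
  {subset s <= t} -> (forall i, 0 <= F i) ->
  \sum_(i <- s) F i <= \sum_(i <- t) F i.
Proof.
move=> us ut st F0.
have /(perm_big _) -> /= : perm_eq s [seq i <- t | i \in s].
  apply: uniq_perm => //; first exact: filter_uniq.
  by move=> i; rewrite mem_filter; case: (boolP (i \in s)) => // /st ->.
by rewrite big_filter [leRHS](bigID (mem s)) /= lerDl sumr_ge0.
Qed.

End finite_choices.

Section weak_limits.
Context {R : realType}.
Local Notation C := R[i].
Local Notation D := (@unit_disk R).
Local Notation W := (@normalized_area R).
Implicit Types (f g : C -> C) (x y z l : C) (L : set C) (s : seq C) (p : {poly C}).

Lemma sample_continuous p l (e : R) : D l -> 0 < e ->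
  exists2 d : R, 0 < d & forall z, cabs (z - l) < d ->
    `|sample (horner p) z - sample (horner p) l| < e.
Proof.
move=> lD e0; pose q : R * R := (complex.Re l, complex.Im l).
have ql : q.1 +i* q.2 = l by rewrite /q /=; case: (l).
have : {for q, continuous (fun q : R * R => sample (horner p) (q.1 +i* q.2))}.
  have c1 := analytic_continuous_cabs (horner p) q (analytic_horner _ _).
  rewrite ql in c1; move/(_ lD) : c1 => c1.
  have c2 := @continuous_cabs_plane R q.
  rewrite /sample /=; apply: cvgM; first exact: cvg_sqr.
  by apply: cvg_sqr; apply: cvgB; [exact: cvg_cst|exact: cvg_sqr].
move=> /cvgrPdist_lt/(_ e e0)/nbhs_ballP[d d0 dP].
exists d => // z zd; rewrite distrC -ql.
have zE : complex.Re z +i* complex.Im z = z by case: (z).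
have := dP (complex.Re z, complex.Im z); rewrite /= zE; apply.
have e2 := sqr_cabs (z - l).
have z0 := cabs_ge0 (z - l).
have [h1 h2] : `|complex.Re (z - l)| <= cabs (z - l) /\ `|complex.Im (z - l)| <= cabs (z - l).
  by split; rewrite -(@ler_pXn2r _ 2) ?nnegrE// real_normK ?num_real// e2
    ?lerDl ?lerDr sqr_ge0.
have [E1 E2] : complex.Re (z - l) = complex.Re z - complex.Re l /\ complex.Im (z - l) = complex.Im z - complex.Im l.
  by case: (z) (l) => a b [].
by split; rewrite /ball /= distrC -?E1 -?E2 (le_lt_trans _ zd).
Qed.

Section limit_of_families.
Variables (L : set C) (s_ : nat -> seq C) (A B : R) (n0 : nat).
Hypothesis LD : L `<=` D.
Hypothesis us : forall n, uniq (s_ n).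
Hypothesis sD : forall n x, x \in s_ n -> cabs x < 1.
Hypotheses (A0 : 0 < A) (B0 : 0 < B).
Hypothesis lower : forall n p, (n0 <= n)%N -> (size p <= n.+1)%N ->
  A * (W * coef_norm2 p) <= \sum_(x <- s_ n) poly_sample n (horner p) x.
Hypothesis upper : forall n p, (n0 <= n)%N -> (size p <= n.+1)%N ->
  \sum_(x <- s_ n) poly_sample n (horner p) x <= B * (W * coef_norm2 p).
Hypothesis approx : forall rho e : R, 0 < rho -> rho < 1 -> 0 < e ->
  \forall n \near \oo,
    (forall x, x \in s_ n -> cabs x <= rho -> exists2 y, L y & cabs (x - y) < e) /\
    (forall y, L y -> cabs y <= rho -> exists2 x, x \in s_ n & cabs (x - y) < e).

Let upper_sample n p : (n0 <= n)%N -> (size p <= n.+1)%N ->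
  \sum_(x <- s_ n) sample (horner p) x <= B * (W * coef_norm2 p).
Proof.
move=> nn0 pn; apply: le_trans (upper _ _ nn0 pn).
by rewrite big_seq [leRHS]big_seq; apply: ler_sum => x /sD; exact: sample_le_poly_sample.
Qed.

(** Points of [L] in [s] are approximated by distinct points of the [n]-th set,
    where the kernel [k_n] is at most [k]. *)
Lemma weak_limit_upper p s : uniq s -> [set` s] `<=` L ->
  \sum_(l <- s) sample (horner p) l <= B * (W * coef_norm2 p).
Proof.
move=> uqs sL; apply/ler_addgt0Pr => e e0.
pose eta := e / (size s).+1%:R.
have eta0 : 0 < eta by rewrite divr_gt0// ltr0n.
have [d d0 dP] : exists2 d : R, 0 < d & forall l, l \in s ->
    (forall z, cabs (z - l) < d -> `|sample (horner p) z - sample (horner p) l| < eta).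
  apply: common_radius => [l d d' _ dd' H z zd|l /sL/LD lD].
    by apply: H; exact: lt_le_trans dd'.
  exact: sample_continuous.
have [r r0 rP] : exists2 r : R, 0 < r & forall l, l \in s -> cabs l <= 1 - r.
  apply: common_radius => [l u u' _ uu' h|l /sL/LD lD].
    by apply: le_trans h _; lra.
  by exists (1 - cabs l); rewrite ?subr_gt0//; lra.
have [c c0 cP] : exists2 c : R, 0 < c & forall l, l \in s -> forall k, k \in s -> k != l -> 2 * c <= cabs (k - l).
  apply: common_radius => [l u u' _ uu' h k ks kl|l ls].
    by apply: le_trans (h k ks kl); lra.
  apply: (@common_radius _ _ (fun k c => k != l -> 2 * c <= cabs (k - l))).
    by move=> k u u' _ uu' h kl; apply: le_trans (h kl); lra.
  move=> k _; have [->|kl] := eqVneq k l; first by exists 1; rewrite ?eqxx.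
  exists (cabs (k - l) / 2); first by rewrite divr_gt0// cabs_gt0 subr_eq0.
  by move=> _; lra.
pose del := Num.min c d.
have del0 : 0 < del by rewrite lt_min c0.
pose rho := Num.max 2^-1 (1 - r).
have rho0 : 0 < rho by rewrite lt_max invr_gt0 ltr0n.
have rho1 : rho < 1 by rewrite gt_max invf_lt1// ltr1n /=; lra.
have H := approx rho del rho0 rho1 del0.
near \oo => n.
have nn0 : (n0 <= n)%N by near: n; exact: nbhs_infty_ge.
have pn : (size p <= n.+1)%N by apply: leqW; near: n; exact: nbhs_infty_ge.
have [_ near_s] : (forall x, x \in s_ n -> cabs x <= rho -> exists2 y, L y & cabs (x - y) < del) /\
    (forall y, L y -> cabs y <= rho -> exists2 x, x \in s_ n & cabs (x - y) < del).
  by near: n.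
have /choice[phi phiP] : forall l, exists x, l \in s -> x \in s_ n /\ cabs (x - l) < del.
  move=> l; have [ls|_] := boolP (l \in s); last by exists 0.
  have [|x xs xl] := near_s l (sL l ls); first by rewrite le_max rP ?orbT.
  by exists x.
have phi_inj : {in s &, injective phi}.
  move=> k l ks ls kl; apply/eqP/negPn/negP => kneql.
  have := cP l ls k ks kneql; have [_ h1] := phiP k ks; have [_ h2] := phiP l ls.
  rewrite kl in h1; have := ler_cabsB (phi l - l) (phi l - k).
  have -> : phi l - l - (phi l - k) = k - l by rewrite opprB addrC subrKA.
  have cd : del <= c by rewrite ge_min lexx.
  by move=> h3 h4; move: h1 h2 h3 h4; lra.
apply: le_trans (_ : \sum_(l <- s) (sample (horner p) (phi l) + eta) <= _).
  rewrite big_seq [leRHS]big_seq; apply: ler_sum => l ls.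
  have [_ pl] := phiP l ls.
  have := dP l ls (phi l) (lt_le_trans pl _); rewrite ge_min lexx orbT => /(_ isT).
  by rewrite ltr_norml => /andP[]; lra.
rewrite big_split /= big_const_seq count_predT iter_addr_0; apply: lerD.
  rewrite -(big_map phi xpredT (sample (horner p))).
  apply: le_trans (upper_sample n p nn0 pn).
  apply: ler_sum_subset => //; last exact: sample_ge0.
    by rewrite map_inj_in_uniq.
  by move=> x /mapP[l ls ->]; have [] := phiP l ls.
rewrite -[leLHS]mulr_natr /eta -mulrA ler_piMr ?(ltW e0)// mulrC ler_pdivrMr ?ltr0n//.
by rewrite mul1r ler_nat.
Unshelve. all: by end_near. Qed.

(** The upper inequality for the constant [1] bounds the number of points. *)
Lemma weak_limit_locally_finite rho : rho < 1 ->
  exists2 t : seq C, uniq t & forall l, L l /\ cabs l <= rho <-> l \in t.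
Proof.
move=> rho1; pose S := [set l | L l /\ cabs l <= rho].
have fS : finite_set S.
  apply: (@finite_set_of_sum_bound _ _ _ (sample (horner 1)) (B * (W * 1)) ((1 - rho) ^+ 2)).
  - exact: sample_ge0.
  - by rewrite exprn_gt0// subr_gt0.
  - move=> l [/LD lD lr]; rewrite /sample hornerC cabs1 expr1n mul1r.
    have c0 := cabs_ge0 l; have c1 : cabs l < 1 by [].
    rewrite lerXn2r ?nnegrE ?subr_ge0 ?(ltW rho1)//; nra.
  - apply/(esum_leP _ _ _ (sample_ge0 _)) => s uqs sS.
    by rewrite -coef_norm2_1; apply: weak_limit_upper => // l /sS[].
move/finite_seqP : fS => [t St]; exists (undup t); first exact: undup_uniq.
by move=> l; rewrite mem_undup -[_ /\ _]/(S l) St.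
Qed.

(** The reproducing kernel at [l], truncated to a degree [m] depending on [l]
    and normalized, has norm at most [1] but samples bounded below near [l].  So
    boundedly many points of the approximating sets may accumulate at [l]. *)
Lemma kernel_peak l : D l -> exists2 q : {poly C}, coef_norm2 q <= 1 &
  exists2 d : R, 0 < d & forall z, cabs (z - l) < d -> 100^-1 <= sample (horner q) z.
Proof.
move=> lD; have l1 : cabs l < 1 by [].
set x := cabs l ^+ 2; have x0 : 0 <= x by exact: sqr_ge0.
have x1 : x < 1 by exact: cabs2_lt1.
pose m := (Num.bound (1 - x)^-1).
have m1 : 1 <= m.+1%:R * (1 - x).
  rewrite -ler_pdivrMr ?subr_gt0// div1r ltW//.
  apply: lt_trans (archi_boundP _) _; first by rewrite invr_ge0 subr_ge0 ltW.
  by rewrite ltr_nat.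
have m0 : (0 < m)%N.
  rewrite -(ltr_nat R); apply: le_lt_trans (archi_boundP _); rewrite invr_ge0 subr_ge0 ltW//.
pose k := diag_kernel m x.
have k9 : 9^-1 <= k * (1 - x) ^+ 2.
  apply: le_trans (diag_kernel_ge m x 1 m0 x0 (ltW x1) ltr01 m1).
  by rewrite (_ : (1 / (2 + 1)) ^+ 2 = 9^-1 :> R)//; field.
have k1 : k * (1 - x) ^+ 2 <= 1 := diag_kernel_le m x x0 (ltW x1).
pose q : {poly C} := \poly_(j < m.+1) ((1 - x)%:C * (j.+1%:R * l^* ^+ j)).
have ql : q.[l] = ((1 - x) * k)%:C.
  rewrite horner_poly rmorphM /k /diag_kernel rmorph_sum mulr_sumr.
  apply: eq_bigr => j _; rewrite -!mulrA -exprMn [l^* * l]mulrC mulJ_cabs.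
  by rewrite [in RHS]rmorphM [in RHS]rmorph_nat [in RHS]rmorphXn.
exists q.
  rewrite (@coef_norm2E _ m.+1) ?size_poly//; apply: le_trans k1.
  rewrite le_eqVlt; apply/orP; left; apply/eqP.
  rewrite /k /diag_kernel mulr_suml; apply: eq_bigr => j _.
  rewrite coef_poly ltn_ord !cabsM cabsX cabsJ cabs_nat cabsR ![in LHS]exprMn [(cabs l ^+ j) ^+ 2]exprAC.
  rewrite real_normK ?num_real// -/x.
  have : j.+1%:R != 0 :> R by rewrite pnatr_eq0.
  by move: (j.+1%:R : R) => c c0; field.
(* the sample at [l] itself is at least [1 / 81]; [1 / 100] leaves some room *)
have [d d0 dP] := @sample_continuous q l (81^-1 - 100^-1) lD ltac:(lra).
exists d => // z /dP; rewrite ltr_norml => /andP[+ _].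
suff : 81^-1 <= sample (horner q) l by lra.
rewrite /sample ql cabsR real_normK ?num_real// -/x.
have -> : ((1 - x) * k) ^+ 2 * (1 - x) ^+ 2 = (k * (1 - x) ^+ 2) ^+ 2 by ring.
have -> : 81^-1 = 9^-1 ^+ 2 :> R by field.
by rewrite lerXn2r ?nnegrE//; lra.
Qed.

Let close l (d : R) x : R := if cabs (x - l) < d then 1 else 0.

Lemma close_ge0 l d x : 0 <= close l d x.
Proof. by rewrite /close; case: ifP. Qed.

Lemma weak_limit_multiplicity l : L l -> exists2 d : R, 0 < d &
  \forall n \near \oo, \sum_(x <- s_ n) close l d x <= 100 * (B * W).
Proof.
move=> /LD/kernel_peak[q q1 [d d0 dP]]; exists d => //.
near=> n; have nn0 : (n0 <= n)%N by near: n; exact: nbhs_infty_ge.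
have qn : (size q <= n.+1)%N by apply: leqW; near: n; exact: nbhs_infty_ge.
apply: le_trans (_ : 100 * \sum_(x <- s_ n) sample (horner q) x <= _).
  rewrite mulr_sumr; apply: ler_sum => x _; rewrite /close; case: ifP => [/dP|_].
    by move=> h; rewrite -ler_pdivrMl// mulr1.
  by rewrite mulr_ge0 ?sample_ge0.
rewrite ler_wpM2l//; apply: le_trans (upper_sample n q nn0 qn) _.
by rewrite ler_wpM2l ?(ltW B0)// ler_piMr ?normalized_area_ge0.
Unshelve. all: by end_near. Qed.

Lemma near_in_seq (P : C -> nat -> Prop) (t : seq C) :
  (forall l, l \in t -> \forall n \near \oo, P l n) ->
  \forall n \near \oo, forall l, l \in t -> P l n.
Proof.
elim: t => [|l t IHt] H; first exact: nearW.
have H1 := H l (mem_head _ _).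
have H2 : \forall n \near \oo, forall k, k \in t -> P k n.
  by apply: IHt => k kt; apply: H; rewrite in_cons kt orbT.
near=> n => k; rewrite in_cons => /orP[/eqP ->|]; first by near: n.
by move: k; near: n.
Unshelve. all: by end_near. Qed.

Lemma horner_bound p z : cabs z <= 1 -> cabs p.[z] <= \sum_(j < size p) cabs p`_j.
Proof.
move=> z1; rewrite horner_coef; apply: le_trans (ler_cabs_sum _ _ _ _) _.
apply: ler_sum => j _; rewrite cabsM cabsX ler_piMr ?cabs_ge0//.
by rewrite exprn_ile1 ?cabs_ge0.
Qed.

(** The points inside a disk of radius [rho < 1] are close to points of the limit,
    and boundedly many are close to the same one.  Those outside contribute
    little: on them [|z ^ m| ^ 2 >= 1 / 2], while the squared norm of [z ^ m] is
    of order [1 / (m + 1)].  The factor [9] compares [k_n] with [k] inside the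
    smaller disk, and the other one bounds the multiplicity. *)
Lemma weak_limit_lower p T :
  (forall s, uniq s -> [set` s] `<=` L -> \sum_(l <- s) sample (horner p) l <= T) ->
  A * (W * coef_norm2 p) <= 9 * (100 * (B * W) + 1) * T.
Proof.
move=> TP; set N := 100 * (B * W) + 1.
have W0 : 0 <= W := normalized_area_ge0.
have BW0 : 0 <= B * W by rewrite mulr_ge0 ?(ltW B0).
have N0 : 0 < N by rewrite /N; lra.
apply/ler_addgt0Pr => e e0.
pose M := \sum_(j < size p) cabs p`_j.
have M0 : 0 <= M by apply: sumr_ge0 => j _; exact: cabs_ge0.
pose c := 2 * M ^+ 2 * (B * W).
have c0 : 0 <= c by rewrite mulr_ge0// mulr_ge0// sqr_ge0.
pose m := Num.bound (c / (e / 2)).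
have mc : c / m.+1%:R <= e / 2.
  have e2 : 0 < e / 2 by rewrite divr_gt0.
  rewrite ler_pdivrMr ?ltr0n// mulrC -ler_pdivrMr//.
  apply: ltW; apply: lt_trans (archi_boundP _) _; first by rewrite divr_ge0// ltW.
  by rewrite ltr_nat.
pose u : R := (4 * m.+1%:R)^-1.
have m10 : 0 < m.+1%:R :> R by rewrite ltr0n.
have u0 : 0 < u by rewrite invr_gt0 mulr_gt0.
have m11 : 1 <= m.+1%:R :> R by rewrite ler1n.
have u4 : u <= 4^-1 by rewrite lef_pV2 ?posrE ?mulr_gt0//; lra.
have half : 2^-1 <= (1 - u) ^+ (2 * m).
  apply: le_trans (bernoulli _ _ (ltW u0) _); last by lra.
  have -> : (2 * m)%:R * u = 2^-1 * (m%:R / m.+1%:R).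
    by rewrite /u natrM invfM mulrA; field; rewrite gt_eqF.
  have : m%:R / m.+1%:R <= 1 :> R by rewrite ler_pdivrMr// mul1r ler_nat.
  by move: (_ / _ : R) => y; lra.
clearbody u m; pose rho := 1 - u; pose rho' := (1 + rho) / 2.
have [rho0 rho1 rho'1] : [/\ 0 < rho, rho < 1 & rho' < 1].
  by rewrite /rho' /rho; split; lra.
have [t ut tP] := weak_limit_locally_finite rho' rho'1.
pose K := 9 * N * (size t).+1%:R.
have K0 : 0 < K by rewrite !mulr_gt0// ltr0n.
pose eta := e / 2 / K.
have eta0 : 0 < eta by rewrite divr_gt0// divr_gt0.
have [d d0 dP] : exists2 d : R, 0 < d & forall l, l \in t ->
    (forall z, cabs (z - l) < d -> `|sample (horner p) z - sample (horner p) l| < eta) /\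
    \forall n \near \oo, \sum_(x <- s_ n) close l d x <= 100 * (B * W).
  apply: common_radius => [l r r' _ rr' [H1 H2]|l /tP[lL _]].
    split=> [z zr|]; first by apply: H1; exact: lt_le_trans rr'.
    apply: filterS H2 => n; apply: le_trans; apply: ler_sum => x _.
    rewrite /close; case: ifP => [xr|_]; last by case: ifP.
    by rewrite (lt_le_trans xr rr').
  have [d1 d10 d1P] := sample_continuous p _ _ (LD _ lL) eta0.
  have [d2 d20 d2P] := weak_limit_multiplicity _ lL.
  exists (Num.min d1 d2); first by rewrite lt_min d10.
  split=> [z|]; first by rewrite lt_min => /andP[/d1P].
  apply: filterS d2P => n; apply: le_trans; apply: ler_sum => x _.
  rewrite /close lt_min; case: (cabs (x - l) < d2); rewrite ?andbT ?andbF//.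
  by case: ifP.
pose del := Num.min d (u / 2).
have del0 : 0 < del by rewrite lt_min d0 divr_gt0.
have near_x := approx rho del rho0 rho1 del0.
have mult : \forall n \near \oo, forall l, l \in t -> \sum_(x <- s_ n) close l d x <= 100 * (B * W).
  by apply: near_in_seq => l /dP[].
near \oo => n.
have nn0 : (n0 <= n)%N by near: n; exact: nbhs_infty_ge.
have pn : (size p <= n.+1)%N by apply: leqW; near: n; exact: nbhs_infty_ge.
have mn : (m <= n)%N by near: n; exact: nbhs_infty_ge.
have npos : (0 < n)%N by near: n; exact: nbhs_infty_gt.
have nu : 1 <= n.+1%:R * u.
  have : (Num.bound u^-1 <= n)%N by near: n; exact: nbhs_infty_ge.
  move=> h; rewrite -ler_pdivrMr// div1r ltW//.
  apply: lt_le_trans (archi_boundP _) _; first by rewrite invr_ge0 ltW.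
  by rewrite ler_nat leqW.
have [near_s _] : (forall x, x \in s_ n -> cabs x <= rho -> exists2 y, L y & cabs (x - y) < del) /\
    (forall y, L y -> cabs y <= rho -> exists2 x, x \in s_ n & cabs (x - y) < del).
  by near: n.
have multn : forall l, l \in t -> \sum_(x <- s_ n) close l d x <= 100 * (B * W).
  by near: n.
apply: le_trans (lower n p nn0 pn) _.
pose h l := sample (horner p) l + eta.
have h0 l : 0 <= h l by rewrite addr_ge0 ?sample_ge0 ?(ltW eta0).
(* each sample is charged to the limit points close to [x], or to the tail *)
have split_x x : x \in s_ n -> poly_sample n (horner p) x <=
    9 * (\sum_(l <- t) h l * close l d x) + 2 * M ^+ 2 * poly_sample n (horner 'X^m) x.
  move=> xs; have x1 := sD _ _ xs.
  have sum0 : 0 <= \sum_(l <- t) h l * close l d x.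
    by apply: sumr_ge0 => l _; rewrite mulr_ge0 ?close_ge0.
  have tail0 : 0 <= 2 * M ^+ 2 * poly_sample n (horner 'X^m) x.
    by rewrite mulr_ge0 ?poly_sample_ge0// mulr_ge0 ?sqr_ge0.
  have [xr|xr] := leP (cabs x) rho.
    apply: ler_wpDr => //.
    have ps : poly_sample n (horner p) x <= 9 * sample (horner p) x.
      have g1 : 1 <= n.+1%:R * (1 - cabs x).
        by apply: le_trans nu _; rewrite ler_wpM2l//; rewrite /rho in xr; lra.
      have := poly_sample_le_sample n (horner p) x 1 npos x1 ltr01 g1.
      rewrite (_ : (1 / (2 + 1)) ^+ 2 = 9^-1 :> R); last by field.
      by lra.
    apply: le_trans ps _; rewrite ler_wpM2l//.
    have [l Ll xl] := near_s x xs xr.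
    have xld : cabs (x - l) < d by apply: lt_le_trans xl _; rewrite ge_min lexx.
    have xlu : cabs (x - l) < u / 2.
      by apply: lt_le_trans xl _; rewrite ge_min lexx orbT.
    have lt : l \in t.
      apply/tP; split=> //; have := lerB_cabs l x; rewrite cabsB /rho' /rho.
      by rewrite /rho in xr; lra.
    rewrite (bigD1_seq l)//= {1}/close xld mulr1 -[leLHS]addr0; apply: lerD.
      have [+ _] := dP l lt; move=> /(_ x xld); rewrite ltr_norml /h => /andP[_]; lra.
    by apply: sumr_ge0 => k _; rewrite mulr_ge0 ?close_ge0.
  apply: ler_wpDl; first by rewrite mulr_ge0.
  have k0 := diag_kernel_gt0 n _ (sqr_ge0 (cabs x)).
  rewrite /poly_sample mulrA ler_pM2r ?invr_gt0//.
  apply: le_trans (_ : M ^+ 2 <= _).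
    by rewrite lerXn2r ?nnegrE ?cabs_ge0// horner_bound// ltW.
  rewrite mulrAC ler_peMl ?sqr_ge0// hornerXn cabsX -exprM mulnC.
  have : (1 - u) ^+ (2 * m) <= cabs x ^+ (2 * m).
    by rewrite lerXn2r ?nnegrE ?cabs_ge0 ?(ltW xr)// ltW.
  lra.
apply: le_trans (_ : \sum_(x <- s_ n) (9 * (\sum_(l <- t) h l * close l d x) + 2 * M ^+ 2 * poly_sample n (horner 'X^m) x) <= _).
  by rewrite big_seq [leRHS]big_seq; apply: ler_sum.
rewrite big_split -!mulr_sumr /= exchange_big /=.
have tail : 2 * M ^+ 2 * \sum_(x <- s_ n) poly_sample n (horner 'X^m) x <= e / 2.
  have Xn : (size ('X^m : {poly C}) <= n.+1)%N by rewrite size_polyXn ltnS.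
  have S1 : \sum_(x <- s_ n) poly_sample n (horner 'X^m) x <= B * W / m.+1%:R.
    apply: le_trans (upper n 'X^m nn0 Xn) _.
    rewrite -mulrA ler_wpM2l ?(ltW B0)// ler_wpM2l// -[_^-1]div1r ler_pdivlMr// mulrC.
    have := @coef_norm2_XnM R 1 m m; rewrite size_poly1 mul1n mulr1 coef_norm2_1.
    exact.
  apply: le_trans mc; have -> : c / m.+1%:R = 2 * M ^+ 2 * (B * W / m.+1%:R).
    by rewrite /c; ring.
  by rewrite ler_wpM2l// mulr_ge0// sqr_ge0.
have head : 9 * \sum_(l <- t) \sum_(x <- s_ n) h l * close l d x <= 9 * N * T + e / 2.
  apply: le_trans (_ : 9 * \sum_(l <- t) h l * N <= _).
    rewrite ler_wpM2l// big_seq [leRHS]big_seq; apply: ler_sum => l lt.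
    rewrite -mulr_sumr ler_wpM2l//; apply: le_trans (multn l lt) _; rewrite /N; lra.
  rewrite -mulr_suml /h big_split /= big_const_seq count_predT iter_addr_0.
  have Tt : \sum_(l <- t) sample (horner p) l <= T.
    by apply: TP => // l /tP[].
  rewrite -[eta *+ _]mulr_natr.
  have -> : e / 2 = 9 * N * (eta * (size t).+1%:R).
    rewrite /eta /K; field; rewrite !gt_eqF//.
  rewrite -mulrDr -mulrA ler_wpM2l// mulrC ler_wpM2l ?(ltW N0)// lerD// ler_wpM2l ?(ltW eta0)// ler_nat//.
by apply: le_trans (lerD head tail) _; lra.
Unshelve. all: by end_near. Qed.

End limit_of_families.
End weak_limits.

(** * Hausdorff distances *)
Section hausdorff.
Context {R : realType}.
Local Notation C := R[i].
Local Notation D := (@unit_disk R).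
Local Notation W := (@normalized_area R).
Implicit Types (x y z l : C) (L E F : set C).

(** For the pseudohyperbolic distance, because [|1 - x * y^*| <= 2]. *)
Lemma euclidean_le_dist (d : C -> C -> R) x y :
  d = @euclidean_dist R \/ d = @pseudohyperbolic_dist R ->
  cabs x < 1 -> cabs y < 1 -> cabs (x - y) <= 2 * d x y.
Proof.
move=> + x1 y1; have c0 := cabs_ge0 (x - y).
case=> ->; rewrite /euclidean_dist; first by lra.
rewrite /pseudohyperbolic_dist cabsM cabsV mulrA.
have xy : cabs (x * y^*) < 1.
  by rewrite cabsM cabsJ; have := cabs_ge0 x; have := cabs_ge0 y; nra.
have lo := lerB_cabs 1 (x * y^*); have hi := ler_cabsB 1 (x * y^*).
rewrite cabs1 in lo hi.
by rewrite ler_pdivlMr; [nra|lra].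
Qed.

Lemma hausdorff_dist_lt (d : C -> C -> R) E F (e : R) :
  (hausdorff_dist d E F < e%:E)%E ->
  (forall x, E x -> exists2 y, F y & d x y < e) /\
  (forall y, F y -> exists2 x, E x & d x y < e).
Proof.
rewrite /hausdorff_dist gt_max => /andP[h1 h2]; split=> z zE.
  have : (ereal_inf [set (d z y)%:E | y in F] < e%:E)%E.
    by apply: le_lt_trans h1; apply: ereal_sup_ubound; exists z.
  by move=> /ereal_inf_lt[_ [y Fy <-]]; rewrite lte_fin; exists y.
have : (ereal_inf [set (d x z)%:E | x in E] < e%:E)%E.
  by apply: le_lt_trans h2; apply: ereal_sup_ubound; exists z.
by move=> /ereal_inf_lt[_ [x Ex <-]]; rewrite lte_fin; exists x.
Qed.

(** In a slightly larger disk, the boundary circle is too far away to be the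
    point that the distance provides. *)
Lemma weak_limit_approx (d : C -> C -> R) (L_ : nat -> set C) L (rho e : R) :
  d = @euclidean_dist R \/ d = @pseudohyperbolic_dist R ->
  (forall n, (0 < n)%N -> L_ n `<=` D) -> weak_limit d L_ L ->
  0 < rho -> rho < 1 -> 0 < e ->
  \forall n \near \oo,
    (forall x, L_ n x -> cabs x <= rho -> exists2 y, L y & cabs (x - y) < e) /\
    (forall y, L y -> cabs y <= rho -> exists2 x, L_ n x & cabs (x - y) < e).
Proof.
move=> dE LnD [LD wl] rho0 rho1 e0; pose r := (1 + rho) / 2.
have [r0 r1 rr] : [/\ 0 < r, r < 1 & rho < r] by rewrite /r; split; lra.
have disk : closed_disk 0 r `<=` D.
  by move=> z; rewrite /closed_disk /= subr0 => zr; exact: le_lt_trans zr r1.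
pose eta := Num.min e (r - rho) / 2.
have m0 : 0 < Num.min e (r - rho) by rewrite lt_min e0 subr_gt0.
have eta0 : 0 < eta by rewrite divr_gt0.
have [ee er] : 2 * eta <= e /\ 2 * eta <= r - rho.
  have e1 : Num.min e (r - rho) <= e by rewrite ge_min lexx.
  have e2 : Num.min e (r - rho) <= r - rho by rewrite ge_min lexx orbT.
  by rewrite /eta; split; lra.
pose cut (S : set C) := S `&` closed_disk 0 r `|` circle 0 r.
have H : \forall n \near \oo, (hausdorff_dist d (cut (L_ n)) (cut L) < eta%:E)%E.
  apply: (wl 0 r r0 disk [set x | (x < eta%:E)%E]).
  apply: open_nbhs_nbhs; split; last by rewrite /= lte_fin.
  exact: open_ereal_lt_ereal.
near=> n; have npos : (0 < n)%N by near: n; exact: nbhs_infty_gt.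
have [h1 h2] : (forall x, cut (L_ n) x -> exists2 y, cut L y & d x y < eta) /\
   (forall y, cut L y -> exists2 x, cut (L_ n) x & d x y < eta).
  by apply: hausdorff_dist_lt; near: n.
have far x y : cabs x <= rho -> circle 0 r y -> cabs (x - y) < 2 * eta -> False.
  rewrite /circle /= subr0 => xrho yr xy; have := lerB_cabs y x.
  by rewrite cabsB; lra.
have inD x (S : set C) : S `<=` D -> cut S x -> cabs x < 1.
  by move=> SD [[/SD]//|]; rewrite /circle /= subr0 => ->.
split=> [x xL xrho|y yL yrho].
  have xE : cut (L_ n) x.
    by left; split=> //; rewrite /closed_disk /= subr0; lra.
  have [y yF dxy] := h1 x xE.
  have xy : cabs (x - y) < 2 * eta.
    apply: le_lt_trans (euclidean_le_dist _ _ _ dE (inD _ _ (LnD _ npos) xE) (inD _ _ LD yF)) _.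
    by rewrite ltr_pM2l.
  exists y; last exact: lt_le_trans xy ee.
  by case: yF => [[]//|yc]; case: (far x y xrho yc xy).
have yF : cut L y.
  by left; split=> //; rewrite /closed_disk /= subr0; lra.
have [x xE dxy] := h2 y yF.
have xy : cabs (x - y) < 2 * eta.
  apply: le_lt_trans (euclidean_le_dist _ _ _ dE (inD _ _ (LnD _ npos) xE) (inD _ _ LD yF)) _.
  by rewrite ltr_pM2l.
exists x; last exact: lt_le_trans xy ee.
case: xE => [[]//|xc]; case: (far y x yrho xc _).
by rewrite cabsB.
Unshelve. all: by end_near. Qed.

Lemma sampling_of_weak_limit (d : C -> C -> R) (L_ : nat -> set C) L :
  d = @euclidean_dist R \/ d = @pseudohyperbolic_dist R ->
  MZ_family L_ -> weak_limit d L_ L -> sampling_set L.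
Proof.
move=> dE [Lfin [A [B [n0 [A0 B0 n00 H]]]]] wl; have LD := wl.1.
have /choice[s_ sP] : forall n, exists s : seq C, uniq s /\
    (forall x, x \in s <-> (0 < n)%N /\ L_ n x).
  move=> [|n]; first by exists [::]; split=> // x; split=> // -[].
  have [/finite_seqP[s sE] _] := Lfin n.+1 isT.
  exists (undup s); split; first exact: undup_uniq.
  by move=> x; rewrite mem_undup sE; split=> [|[]].
have us n : uniq (s_ n) by have [] := sP n.
have sL n x : x \in s_ n <-> (0 < n)%N /\ L_ n x by have [_] := sP n; exact.
have sD n x : x \in s_ n -> cabs x < 1.
  by move=> /sL[n1 xL]; have [_] := Lfin n n1; exact.
have bounds n (p : {poly C}) : (n0 <= n)%N -> (size p <= n.+1)%N ->
    A * (W * coef_norm2 p) <= \sum_(x <- s_ n) poly_sample n (horner p) x /\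
    \sum_(x <- s_ n) poly_sample n (horner p) x <= B * (W * coef_norm2 p).
  move=> nn0 pn; have npos : (0 < n)%N := leq_trans n00 nn0.
  have := H n nn0 p pn; rewrite sqr_bergman_norm_horner -!EFinM.
  under eq_fsbigr do rewrite poly_sampleE.
  have -> : L_ n = [set` s_ n].
    by apply/seteqP; split=> x /=; [move=> xL; apply/sL|move/sL => []].
  by rewrite -fsbig_seq// sumEFin !lee_fin.
have approx (rho e : R) : 0 < rho -> rho < 1 -> 0 < e -> \forall n \near \oo,
    (forall x, x \in s_ n -> cabs x <= rho -> exists2 y, L y & cabs (x - y) < e) /\
    (forall y, L y -> cabs y <= rho -> exists2 x, x \in s_ n & cabs (x - y) < e).
  move=> rho0 rho1 e0.
  have LnD n : (0 < n)%N -> L_ n `<=` D by move=> n1; have [] := Lfin n n1.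
  have h := weak_limit_approx _ _ _ _ _ dE LnD wl rho0 rho1 e0.
  near=> n; have npos : (0 < n)%N by near: n; exact: nbhs_infty_gt.
  have [h1 h2] : (forall x, L_ n x -> cabs x <= rho -> exists2 y, L y & cabs (x - y) < e) /\
    (forall y, L y -> cabs y <= rho -> exists2 x, L_ n x & cabs (x - y) < e) by near: n.
  split=> [x /sL[_]|y yL yrho]; first exact: h1.
  by have [x xL xy] := h2 y yL yrho; exists x => //; apply/sL.
pose N := 9 * (100 * (B * W) + 1).
have N0 : 0 < N.
  have : 0 <= B * W by rewrite mulr_ge0 ?normalized_area_ge0 ?(ltW B0).
  by rewrite /N; lra.
have upper p := @weak_limit_upper R L s_ B n0 LD us sD (fun n q nn0 qn => (bounds n q nn0 qn).2) approx p.
apply: (@sampling_set_of_bounds _ L (A / N) B) => //; first by rewrite divr_gt0.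
move=> p; have SB : (\esum_(l in L) (sample (horner p) l)%:E <= (B * (W * coef_norm2 p))%:E)%E.
  by apply/(esum_leP _ _ _ (sample_ge0 _)) => s; exact: upper.
split=> //.
have [T TE] : exists T, \esum_(l in L) (sample (horner p) l)%:E = T%:E.
  have : (0 <= \esum_(l in L) (sample (horner p) l)%:E)%E.
    by apply: esum_ge0 => l _; rewrite lee_fin sample_ge0.
  by case: (\esum_(l in L) _) SB => [t||] // _ _; exists t.
rewrite TE lee_fin mulrAC ler_pdivrMr// [leRHS]mulrC.
apply: (@weak_limit_lower R L s_ A B n0) => //.
- by move=> n q nn0 qn; exact: (bounds n q nn0 qn).1.
- by move=> n q nn0 qn; exact: (bounds n q nn0 qn).2.
- apply/(esum_leP _ _ _ (sample_ge0 _)); by rewrite TE.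
Unshelve. all: by end_near. Qed.

End hausdorff.

Theorem theorem1p1 (R : realType) :
  (forall L : set R[i], sampling_set L ->
     exists g0 : R, 0 < g0 /\
       forall g : R, 0 < g -> g < g0 ->
         MZ_family (fun n => L `&` open_disk0 (1 - g / n%:R))) /\
  (forall L_ : nat -> set R[i], MZ_family L_ ->
     forall d : R[i] -> R[i] -> R,
       d = @euclidean_dist R \/ d = @pseudohyperbolic_dist R ->
     forall L : set R[i], weak_limit d L_ L -> sampling_set L).
Proof.
split=> [L|L_ MZ d dE L]; first exact: MZ_of_sampling.
exact: sampling_of_weak_limit.
Qed.
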